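(* Let $\mathbb{U}$ be either the monoid variety generated by $\{L_2^1,A_0^1,R_2^1\}$ or the monoid variety generated by the symmetric group $S_3$ on three symbols, and let $\mathbb{V}$ be the monoid variety generated by $\mathsf{M}\{x^2\}$. Then $\mathbb{U}$ and $\mathbb{V}$ are Cross monoid varieties, but their join $\mathbb{U}\vee\mathbb{V}$ has exactly $2^{\aleph_0}$ subvarieties, and the lattice of subvarieties of $\mathbb{U}\vee\mathbb{V}$ does not satisfy the ascending chain condition.
   Context: Monoids are algebras in the signature $\{\cdot,1\}$; a monoid variety is a class of monoids defined by a set of identities. The join of two monoid varieties is the smallest monoid variety containing both. A variety is finitely based if it is defined by finitely many identities, finitely generated if it is generated by a finite algebra, and small if it has only finitely many subvarieties; it is Cross if it is finitely based, finitely generated and small. For a semigroup $S$ without identity element, $S^1=S\cup\{1\}$ is the monoid obtained by adjoining an identity element. The semigroups are given by presentations (with $0$ denoting a zero element): $L_2=\langle a,b\mid a^2=ab=a,\ b^2=ba=b\rangle$ (the left-zero semigroup of order two), $R_2=\langle a,b\mid a^2=ba=a,\ b^2=ab=b\rangle$ (the right-zero semigroup of order two), $A_0=\langle a,b\mid a^2=a,\ b^2=b,\ ab=0\rangle$ (of order four). The monoid $\mathsf{M}\{x^2\}=\{1,x,x^2,0\}$ is the monoid with identity $1$, zero $0$, $x\cdot x=x^2$ and $x\cdot x^2=x^2\cdot x=x^2\cdot x^2=0$. *)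

(* Defs.v *)
From HB Require Import structures.
From mathcomp Require Import all_boot all_fingroup.
From mathcomp Require Import all_classical.

Set Implicit Arguments.
Unset Strict Implicit.
Unset Printing Implicit Defensive.

Local Open Scope classical_set_scope.
Local Open Scope group_scope.

(* A variety is a predicate on monoidType.  The type [set monoidType] is
   ill-formed for universe reasons, hence a separate definition. *)
Definition monoidClass : Type := monoidType -> Prop.

Definition subclass (V W : monoidClass) : Prop := forall M, V M -> W M.

(* An identity u = v between words over the countably infinite alphabet nat;
   modulo the monoid axioms, every term in the signature {., 1} is a word. *)
Definition identity : Type := (seq nat * seq nat)%type.

Definition satisfies (M : monoidType) (e : identity) : Prop :=
  forall f : nat -> M, \prod_(i <- e.1) f i = \prod_(i <- e.2) f i.

Definition models (Sigma : set identity) : monoidClass :=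
  fun M => forall e, Sigma e -> satisfies M e.

Definition is_variety (V : monoidClass) : Prop :=
  exists Sigma : set identity, V = models Sigma.

(* The smallest variety containing K; see is_variety_generated and
   sub_variety_generated below. *)
Definition variety_generated (K : monoidClass) : monoidClass :=
  fun M => forall V, is_variety V -> subclass K V -> V M.

Definition variety_join (V W : monoidClass) : monoidClass :=
  variety_generated (fun M => V M \/ W M).

Definition subvariety (V : monoidClass) : Type :=
  {W : monoidClass | is_variety W /\ subclass W V}.

Definition subvariety_le (V : monoidClass) (W1 W2 : subvariety V) : Prop :=
  subclass (sval W1) (sval W2).

Definition equipotent (A B : Type) : Prop := exists f : A -> B, bijective f.

Definition finitely_based (V : monoidClass) : Prop :=
  exists Sigma : set identity, finite_set Sigma /\ V = models Sigma.

Definition finitely_generated (V : monoidClass) : Prop :=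
  exists M : monoidType,
    finite_set [set: M] /\ V = variety_generated (fun N => N = M).

Definition small (V : monoidClass) : Prop :=
  exists n : nat, equipotent 'I_n (subvariety V).

Definition Cross (V : monoidClass) : Prop :=
  [/\ is_variety V, finitely_based V, finitely_generated V & small V].

Definition ascending_chain_condition (T : Type) (le : T -> T -> Prop) : Prop :=
  forall x : nat -> T, (forall n, le (x n) (x n.+1)) ->
    exists n, forall m, (n <= m)%N -> x m = x n.

Lemma is_variety_generated (K : monoidClass) :
  is_variety (variety_generated K).
Proof.
pose Sigma : set identity := fun e => forall M, K M -> satisfies M e.
exists Sigma; apply/funext => M; apply/propext; split=> [|SM V [T ->] KT e Te].
  apply; first by exists Sigma.
  by move=> N KN e; apply.
by apply: SM => N KN; apply: (KT _ KN).
Qed.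

Lemma sub_variety_generated (K : monoidClass) :
  subclass K (variety_generated K).
Proof. by move=> M KM V _; apply. Qed.

(* S^1: None is the adjoined identity.  The identity is adjoined even if S
   already has one; this is only used for semigroups without identity. *)
Definition adjoin1 (S : Type) : Type := option S.

HB.instance Definition _ (S : choiceType) := Choice.on (adjoin1 S).

Section Adjoin1.
Variable S : semigroupType.

Definition adjoin1_mul (x y : adjoin1 S) : adjoin1 S :=
  match x, y with
  | None, _ => y
  | _, None => x
  | Some s, Some t => Some (s * t)
  end.

Lemma adjoin1_mulA : associative adjoin1_mul.
Proof. by move=> [x|] [y|] [z|] //=; rewrite mulgA. Qed.

Lemma adjoin1_mul1x : left_id None adjoin1_mul.
Proof. by []. Qed.

Lemma adjoin1_mulx1 : right_id None adjoin1_mul.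
Proof. by case. Qed.

HB.instance Definition _ := isMonoid.Build (adjoin1 S)
  adjoin1_mulA adjoin1_mul1x adjoin1_mulx1.
End Adjoin1.

(* The semigroups below are given by their multiplication tables; the lemmas
   *_presentation show that they have the intended presentations. *)

Variant L2 : Type := L2a | L2b.

Definition L2_mul (x y : L2) : L2 := x.

Definition L2_code (x : L2) : bool := if x is L2a then true else false.
Definition L2_decode (c : bool) : L2 := if c then L2a else L2b.
Lemma L2_codeK : cancel L2_code L2_decode. Proof. by case. Qed.
HB.instance Definition _ := Finite.copy L2 (can_type L2_codeK).

Lemma L2_mulA : associative L2_mul. Proof. by []. Qed.
HB.instance Definition _ := isSemigroup.Build L2 L2_mulA.

Variant R2 : Type := R2a | R2b.

Definition R2_mul (x y : R2) : R2 := y.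

Definition R2_code (x : R2) : bool := if x is R2a then true else false.
Definition R2_decode (c : bool) : R2 := if c then R2a else R2b.
Lemma R2_codeK : cancel R2_code R2_decode. Proof. by case. Qed.
HB.instance Definition _ := Finite.copy R2 (can_type R2_codeK).

Lemma R2_mulA : associative R2_mul. Proof. by []. Qed.
HB.instance Definition _ := isSemigroup.Build R2 R2_mulA.

Variant A0 : Type := A0a | A0b | A0ba | A0zero.

Definition A0_mul (x y : A0) : A0 :=
  match x, y with
  | A0a, A0a => A0a
  | A0b, A0b => A0b
  | A0b, A0a => A0ba
  | A0b, A0ba => A0ba
  | A0ba, A0a => A0ba
  | _, _ => A0zero
  end.

Definition A0_code (x : A0) : bool * bool :=
  match x with
  | A0a => (true, false)
  | A0b => (false, true)
  | A0ba => (true, true)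
  | A0zero => (false, false)
  end.
Definition A0_decode (c : bool * bool) : A0 :=
  match c with
  | (true, false) => A0a
  | (false, true) => A0b
  | (true, true) => A0ba
  | (false, false) => A0zero
  end.
Lemma A0_codeK : cancel A0_code A0_decode. Proof. by case. Qed.
HB.instance Definition _ := Finite.copy A0 (can_type A0_codeK).

Lemma A0_mulA : associative A0_mul. Proof. by do 3!case. Qed.
HB.instance Definition _ := isSemigroup.Build A0 A0_mulA.

Lemma L2_presentation :
  [/\ L2a * L2a = L2a, L2a * L2b = L2a, L2b * L2b = L2b & L2b * L2a = L2b] /\
  forall (S : semigroupType) (x y : S),
    [/\ x * x = x, x * y = x, y * y = y & y * x = y] ->
    exists! f : L2 -> S, {morph f : u v / u * v} /\ (f L2a = x /\ f L2b = y).
Proof.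
split=> // S x y [xx xy yy yx].
exists (fun u => if u is L2a then x else y); split.
  by split=> // -[] [] /=.
by move=> g [_ [ga gb]]; apply/funext => -[].
Qed.

Lemma R2_presentation :
  [/\ R2a * R2a = R2a, R2b * R2a = R2a, R2b * R2b = R2b & R2a * R2b = R2b] /\
  forall (S : semigroupType) (x y : S),
    [/\ x * x = x, y * x = x, y * y = y & x * y = y] ->
    exists! f : R2 -> S, {morph f : u v / u * v} /\ (f R2a = x /\ f R2b = y).
Proof.
split=> // S x y [xx xy yy yx].
exists (fun u => if u is R2a then x else y); split.
  by split=> // -[] [] /=.
by move=> g [_ [ga gb]]; apply/funext => -[].
Qed.

Lemma A0_presentation :
  [/\ A0a * A0a = A0a, A0b * A0b = A0b, A0a * A0b = A0zero
    & forall u : A0, A0zero * u = A0zero /\ u * A0zero = A0zero] /\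
  forall (S : semigroupType) (x y z : S),
    [/\ x * x = x, y * y = y, x * y = z
      & forall s : S, z * s = z /\ s * z = z] ->
    exists! f : A0 -> S,
      {morph f : u v / u * v} /\ [/\ f A0a = x, f A0b = y & f A0zero = z].
Proof.
split=> [|S x y z [xx yy xy z0]]; first by split=> // -[].
have zl s : z * s = z by case: (z0 s).
have zr s : s * z = z by case: (z0 s).
exists (fun u => match u with
  | A0a => x | A0b => y | A0ba => y * x | A0zero => z end); split.
  split=> // -[] [] /=; rewrite ?zl ?zr //.
  - by rewrite mulgA xy zl.
  - by rewrite mulgA yy.
  - by rewrite -mulgA xx.
  - by rewrite -mulgA xy zr.
  - by rewrite -mulgA [x * (_ * _)]mulgA xy zl zr.
move=> g [gM [ga gb gz]]; apply/funext => -[] //.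
by rewrite -[A0ba]/(A0b * A0a) gM ga gb.
Qed.

(* M{x^2} = {1, x, x^2, 0}. *)
Variant Mxx : Type := Mxx_one | Mxx_x | Mxx_xx | Mxx_zero.

Definition Mxx_mul (u v : Mxx) : Mxx :=
  match u, v with
  | Mxx_one, _ => v
  | _, Mxx_one => u
  | Mxx_x, Mxx_x => Mxx_xx
  | _, _ => Mxx_zero
  end.

Definition Mxx_code (u : Mxx) : bool * bool :=
  match u with
  | Mxx_one => (true, true)
  | Mxx_x => (true, false)
  | Mxx_xx => (false, true)
  | Mxx_zero => (false, false)
  end.
Definition Mxx_decode (c : bool * bool) : Mxx :=
  match c with
  | (true, true) => Mxx_one
  | (true, false) => Mxx_x
  | (false, true) => Mxx_xx
  | (false, false) => Mxx_zero
  end.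
Lemma Mxx_codeK : cancel Mxx_code Mxx_decode. Proof. by case. Qed.
HB.instance Definition _ := Finite.copy Mxx (can_type Mxx_codeK).

Lemma Mxx_mulA : associative Mxx_mul. Proof. by do 3!case. Qed.
Lemma Mxx_mul1x : left_id Mxx_one Mxx_mul. Proof. by []. Qed.
Lemma Mxx_mulx1 : right_id Mxx_one Mxx_mul. Proof. by case. Qed.
HB.instance Definition _ := isMonoid.Build Mxx Mxx_mulA Mxx_mul1x Mxx_mulx1.

(* Main.v *)
Require Import Defs.
From HB Require Import structures.
From mathcomp Require Import all_boot all_fingroup.
From mathcomp Require Import all_classical.
From mathcomp Require Import cyclic alt zify.

(* To separate subvarieties of U \/ V, use the words p_m = cyc_word m, m >= 4, in
   which every letter occurs twice and overlaps exactly its two cyclic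
   neighbours.  Each p_m is an isoterm for U \/ V, so the Rees quotient M(p_m)
   of the free monoid by the non-factors of p_m belongs to U \/ V.  If k <> m,
   no nonempty substitution instance of p_k is a factor of p_m: factors of
   length two of p_m occur only once, so letters are mapped to letters or
   erased; and the gap between the two occurrences of a letter of p_m is 2 or
   2m - 4, so that erasing one letter of p_k forces erasing all of them.  Hence
   M(p_m) satisfies p_k = p_k^2 exactly when k <> m, and these identities define
   distinct subvarieties for distinct sets of indices.

   V has the basis xy = yx, x^3 = x^4.  The first choice of U has the basis
   xyxzx = xyzx: every word reduces to one in which no letter occurs more than
   twice, and two such words are equal in U only if they coincide.  In a
   subvariety, one side of an identity is sorted into the other by adjacent
   transpositions, each of which follows from the two-letter identity obtained
   by erasing the other letters.  The variety of S_3 has the basis x^6 = 1,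
   x^2 y^2 = y^2 x^2, and an identity that fails in S_3 forces commutativity. *)

Set Implicit Arguments.
Unset Strict Implicit.
Unset Printing Implicit Defensive.

Local Open Scope group_scope.

Local Notation ev f u := (\prod_(i <- u) f i) (only parsing).
Local Notation filter := seq.filter.

(** * Monoid varieties and identities *)

Definition holds (K : monoidClass) (e : identity) : Prop :=
  forall M, K M -> satisfies M e.

Definition theory (K : monoidClass) : set identity := fun e => holds K e.

Lemma is_variety_theory (V : monoidClass) : is_variety V -> V = models (theory V).
Proof.
move=> [S ->]; apply/funext => M; apply/propext; split.
  by move=> SM e; apply.
by move=> TM e Se; apply: TM => N; apply.
Qed.

Lemma variety_generatedE (K : monoidClass) :
  variety_generated K = models (theory K).
Proof.
apply/funext => M; apply/propext; split.
  by apply; [exists (theory K) | move=> N KN e; apply].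
move=> TM V [S ->] KS e Se; apply: TM => N KN; exact: (KS N KN).
Qed.

Lemma holds_variety_generated (K : monoidClass) e :
  holds (variety_generated K) e <-> holds K e.
Proof.
split=> [h M KM|h M]; first by apply: h; apply: sub_variety_generated.
by rewrite variety_generatedE; apply.
Qed.

Lemma variety_join_generated (K1 K2 : monoidClass) e :
  holds (variety_join (variety_generated K1) (variety_generated K2)) e <->
  holds K1 e /\ holds K2 e.
Proof.
rewrite holds_variety_generated; split.
  by move=> h; split=> M KM; apply: h; [left|right]; apply: sub_variety_generated.
by move=> [h1 h2] M [|]; apply: (holds_variety_generated _ _).2.
Qed.

Definition wsubst (s : nat -> seq nat) (u : seq nat) : seq nat :=
  flatten (map s u).

Lemma wsubst_cat s u v : wsubst s (u ++ v) = wsubst s u ++ wsubst s v.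
Proof. by rewrite /wsubst map_cat flatten_cat. Qed.

Lemma wsubst_cons s i u : wsubst s (i :: u) = s i ++ wsubst s u.
Proof. by []. Qed.

Lemma ev_wsubst (M : monoidType) (f : nat -> M) s u :
  ev f (wsubst s u) = ev (fun i => ev f (s i)) u.
Proof.
elim: u => [|i u ih]; first by rewrite !big_nil.
by rewrite wsubst_cons big_cat big_cons /= ih.
Qed.

Lemma satisfies_wsubst (M : monoidType) s u v :
  satisfies M (u, v) -> satisfies M (wsubst s u, wsubst s v).
Proof. by move=> h f /=; rewrite !ev_wsubst; apply: h. Qed.

Lemma satisfies_ctx (M : monoidType) a b u v :
  satisfies M (u, v) -> satisfies M (a ++ u ++ b, a ++ v ++ b).
Proof. by move=> h f /=; rewrite !big_cat /= (h f). Qed.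

Lemma ev_filter (M : monoidType) (f : nat -> M) (P : pred nat) u :
  ev f (filter P u) = ev (fun i => if P i then f i else 1) u.
Proof. by rewrite big_filter big_mkcond. Qed.

Lemma satisfies_filter (M : monoidType) P u v :
  satisfies M (u, v) -> satisfies M (filter P u, filter P v).
Proof. by move=> h f /=; rewrite !ev_filter; apply: h. Qed.

Lemma ev_eq_in (M : monoidType) (f g : nat -> M) u :
  {in u, f =1 g} -> ev f u = ev g u.
Proof.
by move=> fg; rewrite big_seq_cond [RHS]big_seq_cond;
  apply: eq_bigr => i; rewrite andbT => /fg.
Qed.

Lemma ev_nseq (M : monoidType) (f : nat -> M) n i : ev f (nseq n i) = f i ^+ n.
Proof.
by elim: n => [|n ih]; rewrite /= ?big_nil ?expg0 // big_cons ih expgS.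
Qed.

Lemma filter_pred1 (x : nat) u : filter (pred1 x) u = nseq (count_mem x u) x.
Proof. by elim: u => //= y u ->; case: eqP => // ->. Qed.

Lemma satisfies_pow (M : monoidType) u v x :
  satisfies M (u, v) ->
  forall a : M, a ^+ count_mem x u = a ^+ count_mem x v.
Proof.
move=> h a; have := satisfies_filter (pred1 x) h (fun=> a).
by rewrite /= !filter_pred1 !ev_nseq.
Qed.

Lemma ev_single (M : monoidType) (x : nat) (a : M) u :
  ev (fun i => if i == x then a else 1) u = a ^+ count_mem x u.
Proof. by rewrite -big_mkcond -big_filter filter_pred1 (ev_nseq (fun=> a)). Qed.

Lemma ev_commute (M : monoidType) (f : nat -> M) n u :
  (forall i j, commute (f i) (f j)) -> all (fun i => i < n)%N u ->
  ev f u = \prod_(i <- iota 0 n) f i ^+ count_mem i u.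
Proof.
move=> fC; elim: u => [_|x u ih /= /andP[xn un]].
  by rewrite big_nil big1 // => i _; rewrite expg0.
rewrite big_cons ih //.
have -> : \prod_(i <- iota 0 n) f i ^+ ((x == i) + count_mem i u) =
   \prod_(i <- iota 0 n) (f i ^+ (x == i) * f i ^+ count_mem i u).
  by apply: eq_bigr => i _; rewrite expgnDr.
rewrite prodgM_commute; last by move=> *; apply: commuteX2.
congr (_ * _); rewrite -[LHS]expg1.
have -> : 1%N = count_mem x (iota 0 n) by rewrite count_uniq_mem ?iota_uniq // mem_iota xn.
rewrite -ev_single; apply: eq_bigr => i _; rewrite eq_sym.
by case: eqP => [->|]; rewrite ?expg0.
Qed.

Lemma word_bound (u v : seq nat) :
  exists n, all (fun i => i < n)%N u /\ all (fun i => i < n)%N v.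
Proof.
exists (\sum_(i <- u ++ v) i).+1; split; apply/allP => i iu; rewrite ltnS.
  by rewrite (big_rem i) ?mem_cat ?iu //= leq_addr.
by rewrite (big_rem i) ?mem_cat ?iu ?orbT //= leq_addr.
Qed.

Lemma equipotent_finType (A : Type) (T : finType) (f : A -> T) :
  injective f -> exists n : nat, equipotent 'I_n A.
Proof.
move=> finj; pose S := [set t : T | `[<exists a, f a = t>]]%SET.
exists #|S|.
have gP (i : 'I_#|S|) : exists a, f a = enum_val i.
  by have := enum_valP i; rewrite inE => /asboolP.
pose g i := sval (cid (gP i)).
have gE i : f (g i) = enum_val i by rewrite /g; case: cid.
have fS a : f a \in S by rewrite inE; apply/asboolP; exists a.
exists g; exists (fun a => enum_rank_in (fS a) (f a)) => [i|a].
  apply: enum_val_inj; rewrite enum_rankK_in ?gE //; exact: enum_valP.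
by apply: finj; rewrite gE enum_rankK_in.
Qed.

(** A variety is recovered from its identities by [is_variety_theory], and the proofs stored in the
    dependent pair are irrelevant. *)
Lemma subvariety_eq (V : monoidClass) (W1 W2 : subvariety V) :
  (forall e, holds (sval W1) e <-> holds (sval W2) e) -> W1 = W2.
Proof.
case: W1 W2 => [W1 [v1 s1]] [W2 [v2 s2]] /= h.
have E : W1 = W2.
  rewrite (is_variety_theory v1) (is_variety_theory v2); congr models.
  by apply/funext => e; apply/propext; apply: h.
by subst W2; congr exist; apply: Prop_irrelevance.
Qed.

(** By hypothesis all identities of a subvariety follow, within [V], from those of [L] that hold in
    it. So that subset of [L] determines the subvariety, and there are at most 2^|L| of them. *)
Lemma small_of_seq (V : monoidClass) (L : seq identity) :
  (forall (W : monoidClass) M e, subclass W V -> V M -> holds W e ->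
     (forall l, l \in L -> holds W l -> satisfies M l) -> satisfies M e) ->
  small V.
Proof.
move=> h.
pose f (W : subvariety V) : {ffun 'I_(size L) -> bool} :=
  [ffun i => `[<holds (sval W) (tnth (in_tuple L) i)>]].
apply: (@equipotent_finType _ _ f) => W1 W2 /ffunP E.
have {}E l : l \in L -> holds (sval W1) l <-> holds (sval W2) l.
  move=> lL; have /tnthP [i ->] : l \in in_tuple L by []; have := E i; rewrite !ffunE => e.
  by split=> /asboolP hl; apply/asboolP; move: hl; rewrite e.
apply: subvariety_eq => e; case: W1 W2 E {f} => [W1 [v1 s1]] [W2 [v2 s2]] /= E.
split=> he M WM.
  by apply: (h W1 M e s1 (s2 M WM) he) => l lL /(E l lL); apply.
by apply: (h W2 M e s2 (s1 M WM) he) => l lL /(E l lL); apply.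
Qed.

(** * Rees quotients of the free monoid *)

Section Rees.
Variable w : seq nat.

(* The non-factor w ++ [:: 0] represents the zero of the quotient. *)
Definition factor_norm (s : seq nat) : seq nat :=
  if infix s w then s else w ++ [:: 0%N].

(** A non-factor stays a non-factor in every context, and [w ++ [:: 0]] is one because it is longer
    than [w]; hence normalisation is compatible with concatenation. *)
Lemma factor_normM (a s b : seq nat) :
  factor_norm (a ++ factor_norm s ++ b) = factor_norm (a ++ s ++ b).
Proof.
rewrite {2}/factor_norm; case: ifPn => // ns; rewrite /factor_norm.
have n1 c : ~~ infix c w -> ~~ infix (a ++ c ++ b) w.
  apply: contraNN => /infixP[p [q ->]]; apply/infixP.
  by exists (p ++ a), (b ++ q); rewrite !catA.
rewrite (negPf (n1 _ ns)) (negPf (n1 _ _)) //.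
by apply/negP => /size_infix; rewrite size_cat /= addn1 ltnn.
Qed.

Lemma factor_norm_id s : factor_norm (factor_norm s) = factor_norm s.
Proof. by have := factor_normM [::] s [::]; rewrite /= !cats0. Qed.

Definition rees : Type := {s : seq nat | factor_norm s == s}.
HB.instance Definition _ := Choice.on rees.

Definition rees_of (s : seq nat) : rees :=
  exist _ (factor_norm s) (introT eqP (factor_norm_id s)).

Definition rees_mul (x y : rees) : rees := rees_of (val x ++ val y).

Lemma rees_mulA : associative rees_mul.
Proof.
move=> x y z; apply: val_inj => /=.
have := factor_normM (val x) (val y ++ val z) [::]; rewrite !cats0 => ->.
by rewrite catA; have := factor_normM [::] (val x ++ val y) (val z).
Qed.

Lemma rees_mul1x : left_id (rees_of [::]) rees_mul.
Proof.
move=> x; apply: val_inj => /=; rewrite [factor_norm [::]]/factor_norm infix0s /=.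
exact/eqP/(valP x).
Qed.

Lemma rees_mulx1 : right_id (rees_of [::]) rees_mul.
Proof.
move=> x; apply: val_inj => /=; rewrite [factor_norm [::]]/factor_norm infix0s cats0 /=.
exact/eqP/(valP x).
Qed.

HB.instance Definition _ := isMonoid.Build rees rees_mulA rees_mul1x rees_mulx1.

Lemma val_ev_rees (f : nat -> rees) u :
  val (ev f u) = factor_norm (wsubst (fun i => val (f i)) u).
Proof.
elim: u => [|i u ih]; first by rewrite big_nil.
rewrite big_cons wsubst_cons /= ih.
by have := factor_normM (val (f i)) (wsubst (fun i => val (f i)) u) [::]; rewrite !cats0.
Qed.

(** If neither side is sent to a factor of [w], both values are zero, so only substitutions with a
    nonzero value matter. *)
Lemma rees_satisfies u v :
  (forall s, infix (wsubst s u) w -> wsubst s v = wsubst s u) ->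
  (forall s, infix (wsubst s v) w -> wsubst s u = wsubst s v) ->
  satisfies rees (u, v).
Proof.
move=> uv vu f; apply: val_inj; rewrite !val_ev_rees /=.
set s := fun i => _.
have [/uv -> //|nu] := boolP (infix (wsubst s u) w).
have [/vu -> //|nv] := boolP (infix (wsubst s v) w).
by rewrite /factor_norm (negPf nu) (negPf nv).
Qed.

Lemma rees_satisfiesN v : satisfies rees (w, v) -> v = w.
Proof.
move=> /(_ (fun i => rees_of [:: i])) /(congr1 val); rewrite !val_ev_rees /=.
have E u : {subset u <= w} ->
    wsubst (fun i => val (rees_of [:: i])) u = u.
  elim: u => // i u ih sub; rewrite wsubst_cons ih => [|j ju]; last first.
    by apply: sub; rewrite inE ju orbT.
  have iw : infix [:: i] w.
    have : i \in w by apply: sub; rewrite mem_head.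
    by case/splitPr => p q; apply/infixP; exists p, q.
  by rewrite /= /factor_norm iw.
rewrite E // {1}/factor_norm infix_refl /factor_norm.
case: ifPn => [vw|nv] Ew; last first.
  by have := congr1 size Ew; rewrite size_cat /=; lia.
have [vsub|/allPn [i iv iw]] := boolP (all (fun i => i \in w) v).
  by rewrite Ew E //; apply/allP.
(* A letter of [v] outside [w] is a non-factor, so its value [w ++ [:: 0]] would lie inside a factor
   of [w], which its length forbids. *)
have : infix (w ++ [:: 0%N]) w.
  apply: infix_trans vw; apply/infixP.
  case/splitPr: iv => p q.
  exists (wsubst (fun i => factor_norm [:: i]) p), (wsubst (fun i => factor_norm [:: i]) q).
  rewrite wsubst_cat wsubst_cons; congr (_ ++ (_ ++ _)).
  rewrite /factor_norm ifN //; apply: contra iw => /infixP [a [b ->]].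
  by rewrite !mem_cat mem_head orbT.
by move=> /size_infix; rewrite size_cat /= addn1 ltnn.
Qed.

End Rees.

Definition isoterm (K : monoidClass) (w : seq nat) : Prop :=
  forall v, holds K (w, v) -> v = w.

(** If one side has a nonzero value, then [w = p s(a) q]. The consequence [w = p s(b) q] of the
    identity must be trivial for an isoterm, so [s(b) = s(a)]. *)
Lemma isoterm_rees (K : monoidClass) w :
  isoterm K w -> models (theory K) (rees w).
Proof.
move=> iso [u v] huv.
suff sub s a b : holds K (a, b) -> infix (wsubst s a) w -> wsubst s b = wsubst s a.
  apply: rees_satisfies => s; apply: sub => //.
  by move=> M KM f; rewrite /= huv.
move=> hab /infixP [p [q E]].
have : p ++ wsubst s b ++ q = w.
  apply: iso => M KM; rewrite E; apply: satisfies_ctx; apply: satisfies_wsubst.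
  exact: hab.
by rewrite E => /eqP; rewrite eqseq_cat // eqxx /= => /eqP F; move: (congr1 size F);
  rewrite !size_cat => /addIn sz; move/eqP: F; rewrite eqseq_cat // => /andP[/eqP].
Qed.

(** * Continuum many subvarieties from independent identities *)

Section Equipotence.
Local Open Scope classical_set_scope.
Local Open Scope card_scope.

Lemma inj_surj_bijective (A B : Type) (f : A -> B) :
  injective f -> (forall b, exists a, f a = b) -> bijective f.
Proof.
move=> finj fsurj; exists (fun b => sval (cid (fsurj b))) => [a|b].
  by apply: finj; case: cid.
by case: cid.
Qed.

(** Cantor-Bernstein is applied to the range of [g] inside [set nat]; the bijection obtained is
    pulled back to [A] along [g]. *)
Lemma equipotent_set_nat (A : Type) (f : set nat -> A) (g : A -> set nat) :
  injective f -> injective g -> equipotent (set nat) A.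
Proof.
move=> finj ginj.
pose R := [set x : set nat | exists a, g a = x].
have /pcard_eqP [h] : [set: set nat] #= R.
  apply: Cantor_Bernstein; last exact: subset_card_le.
  have gf : injective (g \o f) by apply: inj_comp.
  apply: card_le_trans (subset_card_le (_ : range (g \o f) `<=` R)).
    by have /card_eqPle[] := @inj_card_eq _ _ [set: set nat] _ (in2W gf).
  by move=> _ [x _ <-]; exists (f x).
have hR x : exists a, g a = h x by apply: (@funS _ _ _ _ h x).
exists (fun x => sval (cid (hR x))); apply: inj_surj_bijective.
  move=> x y /(congr1 g); case: cid => a /= ->; case: cid => b /= ->.
  by move=> e; apply: (@inj _ _ _ h) => //; rewrite inE.
move=> a; have : R (g a) by exists a.
move=> /(@surj _ _ _ _ h) [x _ hx]; exists x; case: cid => b /= Eb.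
by apply: ginj; rewrite Eb.
Qed.
End Equipotence.

Section Independence.
Variable J : monoidClass.
Variable p : nat -> seq nat.
Hypothesis varJ : is_variety J.
Hypothesis p_isoterm : forall n, isoterm J (p n).
Hypothesis p_nonempty : forall n, p n <> [::].
Hypothesis p_avoids : forall k m s, k <> m ->
  infix (wsubst s (p k)) (p m) -> wsubst s (p k) = [::].

Definition idem_identity (n : nat) : identity := (p n, p n ++ p n).

Lemma rees_idem k m : k <> m -> satisfies (rees (p m)) (idem_identity k).
Proof.
move=> km; apply: rees_satisfies => s; rewrite wsubst_cat.
  by move=> /(p_avoids km) ->.
move=> h; have /(p_avoids km) -> // : infix (wsubst s (p k)) (p m).
by apply: infix_trans h; apply: prefix_infix; apply: prefix_prefix.
Qed.

Lemma rees_idemN m : ~ satisfies (rees (p m)) (idem_identity m).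
Proof.
move=> /rees_satisfiesN /(congr1 size); rewrite size_cat.
by case E : (p m) => [|x s] /=; [case: (p_nonempty E) | lia].
Qed.

Definition idem_class (S : set nat) : monoidClass :=
  fun M => J M /\ forall n, S n -> satisfies M (idem_identity n).

Lemma idem_class_variety S : is_variety (idem_class S) /\ subclass (idem_class S) J.
Proof.
split; last by move=> M [].
exists (fun e => theory J e \/ exists2 n, S n & e = idem_identity n).
apply/funext => M; apply/propext; split.
  by move=> [JM h] e [|[n Sn ->]]; [apply | apply: h].
move=> h; split; last by move=> n Sn; apply: h; right; exists n.
by rewrite (is_variety_theory varJ) => e Je; apply: h; left.
Qed.

Definition idem_subvariety (S : set nat) : subvariety J :=
  exist _ (idem_class S) (idem_class_variety S).

(** If [n] lies in [T] but not in [S], the Rees quotient of [p n] belongs to the class of [S] and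
    not to that of [T]. *)
Lemma idem_class_le S T : subclass (idem_class S) (idem_class T) <-> (forall n, T n -> S n).
Proof.
split=> [h n Tn|h M [JM SM]]; last by split=> // n /h /SM.
apply: contrapT => nS.
have : idem_class S (rees (p n)).
  split; first by rewrite (is_variety_theory varJ); apply: isoterm_rees.
  by move=> k Sk; apply: rees_idem => kn; apply: nS; rewrite -kn.
by move=> /h [_ /(_ n Tn)]; apply: rees_idemN.
Qed.

Lemma subvarieties_continuum : equipotent (set nat) (subvariety J).
Proof.
(* For the upper bound, identities are countable, so a subvariety is encoded by the set of codes of
   its identities. *)
apply: (@equipotent_set_nat _ idem_subvariety
  (fun W n => exists2 e : identity, theory (sval W) e & pickle e = n)).
  move=> S T /(congr1 sval) /= E; apply/funext => n; apply/propext; split.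
    by apply: (idem_class_le T S).1; rewrite E.
  by apply: (idem_class_le S T).1; rewrite E.
move=> W1 W2 E; apply: subvariety_eq => e.
have {}E := congr1 (fun X => X (pickle e)) E.
have sub W W' : (exists2 e' : identity, theory W e' & pickle e' = pickle e) =
      (exists2 e' : identity, theory W' e' & pickle e' = pickle e) ->
    holds W e -> holds W' e.
  move=> EW We; have : exists2 e' : identity, theory W e' & pickle e' = pickle e by exists e.
  by rewrite EW => -[e' We' /(pcan_inj pickleK) <-].
by split; apply: sub.
Qed.

Lemma subvarieties_not_acc : ~ ascending_chain_condition (@subvariety_le J).
Proof.
(* The tails [n <= k] shrink as [n] grows, so their classes increase, strictly by independence. *)
move=> /(_ (fun n => idem_subvariety (fun k => n <= k)%N)) [n|n].
  by apply/idem_class_le => k /ltnW.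
move=> /(_ n.+1 (leqnSn n)) /(congr1 sval) /= E.
have : subclass (idem_class (fun k => n < k)%N) (idem_class (fun k => n <= k)%N).
  by rewrite E.
by move=> /idem_class_le /(_ n (leqnn n)); rewrite ltnn.
Qed.

End Independence.

(** * The cyclic words *)

Section CyclicWords.
Local Open Scope nat_scope.

Definition cyc_letter (m k : nat) : nat :=
  if k == 1 then m.-1 else if odd k then k./2.-1 else k./2.

(* 0 (m-1) (1 0) (2 1) ... (m-1 m-2): every letter occurs twice and overlaps
   exactly its two neighbours in the cyclic order, m-1 containing the others. *)
Definition cyc_word (m : nat) : seq nat := mkseq (cyc_letter m) m.*2.

Lemma size_cyc_word m : size (cyc_word m) = m.*2.
Proof. exact: size_mkseq. Qed.

Lemma nth_cyc_word m k : k < m.*2 -> nth 0 (cyc_word m) k = cyc_letter m k.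
Proof. exact: nth_mkseq. Qed.

Lemma cyc_letter_split m a x b :
  cyc_word m = a ++ x :: b -> x = cyc_letter m (size a) /\ size a + size b = m.*2.-1.
Proof.
move=> E; have := congr1 size E; rewrite size_cyc_word size_cat /= => sz.
split; last by lia.
by rewrite -nth_cyc_word ?E ?nth_cat ?ltnn ?subnn //; lia.
Qed.

(** A letter [l < m-1] sits at positions [2l] and [2l+3], and [m-1] at positions [1] and [2m-2];
    facts about occurrences thus become linear arithmetic. *)
Variant cyc_letter_spec (m k l : nat) : Prop :=
  | CycOne of k = 1 & l = m.-1
  | CycEven of k = l.*2
  | CycOdd of k = l.*2.+3.

Lemma cyc_letterP m k l : l = cyc_letter m k -> cyc_letter_spec m k l.
Proof.
move=> ->; rewrite /cyc_letter; case: eqP => [->|k1]; first exact: CycOne.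
have := odd_double_half k; case: ifP => _ /= E; [apply: CycOdd | apply: CycEven]; lia.
Qed.

Lemma cyc_gap m a x b c : 4 <= m -> cyc_word m = a ++ x :: b ++ x :: c ->
  size b = 2 \/ size b = m.*2 - 4.
Proof.
move=> m4 E; have [E1 s1] := cyc_letter_split E.
have E' : cyc_word m = (a ++ x :: b) ++ x :: c by rewrite E -catA /= -?catA.
have [E2] := cyc_letter_split E'; rewrite size_cat /=.
move: s1; rewrite ?size_cat /=.
by case: (cyc_letterP E1) => ??; case: (cyc_letterP E2); rewrite size_cat /=; lia.
Qed.

(** Every letter except [m-1] occurs first at an even and then at an odd position, so one of the
    adjacent letters [x], [y] is [m-1]. Both cases force [m = 3], where the word is 0 2 1 0 2 1. *)
Lemma cyc_pair m a x y b c : 4 <= m ->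
  cyc_word m <> a ++ x :: y :: b ++ x :: y :: c.
Proof.
move=> m4 E; have [E1 s1] := cyc_letter_split E.
have E' : cyc_word m = (a ++ [:: x, y & b]) ++ x :: y :: c by rewrite E -catA /= -?catA.
have [E2 _] := cyc_letter_split E'.
have F : cyc_word m = (a ++ [:: x]) ++ y :: b ++ x :: y :: c by rewrite E -catA /= -?catA.
have [E3 _] := cyc_letter_split F.
have F' : cyc_word m = (a ++ [:: x, y & b] ++ [:: x]) ++ y :: c by rewrite E -!catA /= -?catA.
have [E4 _] := cyc_letter_split F'.
move: s1; rewrite ?size_cat /= ?size_cat /=.
case: (cyc_letterP E1); case: (cyc_letterP E2); rewrite ?size_cat /= ?size_cat /=; try lia;
case: (cyc_letterP E3); case: (cyc_letterP E4); rewrite ?size_cat /= ?size_cat /=; lia.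
Qed.

Lemma cyc_triple m a x b c d : 4 <= m ->
  cyc_word m <> a ++ x :: b ++ x :: c ++ x :: d.
Proof.
move=> m4 E; have [E1 s1] := cyc_letter_split E.
have E' : cyc_word m = (a ++ x :: b) ++ x :: c ++ x :: d by rewrite E -catA /= -?catA.
have [E2 _] := cyc_letter_split E'.
have F : cyc_word m = (a ++ x :: b ++ x :: c) ++ x :: d by rewrite E -!catA /= -?catA.
have [E3 _] := cyc_letter_split F.
move: s1; rewrite ?size_cat /= ?size_cat /=.
by case: (cyc_letterP E1); case: (cyc_letterP E2); case: (cyc_letterP E3);
  rewrite ?size_cat /= ?size_cat /=; lia.
Qed.

Lemma two_occurrences (x : nat) u : 1 < count_mem x u ->
  exists a b c, u = a ++ x :: b ++ x :: c.
Proof.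
move=> cu; have xu : x \in u by rewrite -has_pred1 has_count; lia.
case/splitPr: xu cu => a v cu; have [xa|xa] := boolP (x \in a).
  by case/splitPr: xa cu => a1 a2 _; exists a1, a2, v; rewrite -catA.
move: cu; rewrite count_cat /= eqxx (count_memPn xa) add0n ltnS -has_count has_pred1.
by case/splitPr => b c; exists a, b, c.
Qed.

Lemma three_occurrences (x : nat) u : 2 < count_mem x u ->
  exists a b c d, u = a ++ x :: b ++ x :: c ++ x :: d.
Proof.
move=> cu; have xu : x \in u by rewrite -has_pred1 has_count; lia.
pose i := index x u.
have iu : i < size u by rewrite index_mem.
have xi : nth 0 u i = x by apply: nth_index.
have u1 : u = take i u ++ x :: drop i.+1 u by rewrite -{1}xi -drop_nth // cat_take_drop.
have cn : count_mem x (take i u) = 0.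
  by apply/count_memPn; rewrite in_take // /i ltnn.
move: cu; rewrite {1}u1 count_cat cn /= eqxx add0n ltnS.
by move=> /two_occurrences [b [c [d E]]]; exists (take i u), b, c, d; rewrite {1}u1 E.
Qed.

Lemma drop_cons2 (s : seq nat) i : i < size s ->
  s = take i s ++ nth 0 s i :: drop i.+1 s.
Proof. by move=> si; rewrite -drop_nth // cat_take_drop. Qed.

(** The two occurrences of [i] enclose exactly its cyclic neighbours; the conditional closes the
    cycle at 0. *)
Lemma cyc_word_factor k i : i < k.-1 ->
  exists a c, cyc_word k =
    a ++ [:: i; (if i == 0 then k.-1 else i.-1); i.+1; i] ++ c.
Proof.
move=> ik; exists (take i.*2 (cyc_word k)), (drop i.*2.+4 (cyc_word k)).
have ik2 : i.*2.+3 < k.*2 by lia.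
have sz j : j <= i.*2.+3 -> j < size (cyc_word k) by rewrite size_cyc_word; lia.
rewrite {1}(drop_cons2 (sz i.*2 _)); last by lia.
rewrite (drop_nth 0 (sz i.*2.+1 _)) ?(drop_nth 0 (sz i.*2.+2 _)); try lia.
rewrite (drop_nth 0 (sz i.*2.+3 _)); last by lia.
rewrite !nth_cyc_word; try lia.
rewrite /cyc_letter /= !odd_double /= ?doubleK ?uphalf_double.
by congr (_ ++ [:: _, _, _, _ & _]); case: (i) => [|j] //=; rewrite odd_double /= doubleK.
Qed.

Lemma cyc_word_last k : 2 <= k ->
  exists b, cyc_word k = 0 :: k.-1 :: b ++ [:: k.-1; k.-2] /\ size b = k.*2 - 4.
Proof.
move=> k2; exists (take (k.*2 - 4) (drop 2 (cyc_word k))).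
have sz := size_cyc_word k; split; last by rewrite size_takel // size_drop sz; lia.
have l j : j < k.*2 -> j < size (cyc_word k) by rewrite sz.
rewrite -{1}[cyc_word k]drop0 (drop_nth 0 (l 0 _)) ?(drop_nth 0 (l 1 _)); try lia.
rewrite !nth_cyc_word; try lia; congr [:: _, _ & _].
rewrite -[LHS](cat_take_drop (k.*2 - 4)) drop_drop; congr (_ ++ _).
rewrite (drop_nth 0 (l _ _)) ?(drop_nth 0 (l (k.*2 - 4 + 2).+1 _)) ?nth_cyc_word; try lia.
rewrite drop_oversize; last by lia.
rewrite /cyc_letter.
congr [:: _; _]; repeat case: ifP; lia.
Qed.

Lemma mem_cyc_word k x : 2 <= k -> x \in cyc_word k -> x < k.
Proof.
move=> k2 /(nthP 0) [j]; rewrite size_cyc_word => jk.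
rewrite nth_cyc_word // => /esym /cyc_letterP [] ?; lia.
Qed.

Lemma cyc_word_twice k x : 2 <= k -> x < k ->
  exists a b c, cyc_word k = a ++ x :: b ++ x :: c.
Proof.
move=> k2 xk; have [xk1|kx] := ltnP x k.-1.
  by have [a [c ->]] := cyc_word_factor xk1; exists a; eexists [:: _; _], c.
have [b [-> _]] := cyc_word_last k2.
by exists [:: 0], b, [:: k.-2]; have -> : x = k.-1 by lia.
Qed.

Lemma cyc_count m z : 4 <= m ->
  count_mem z (cyc_word m) = if z < m then 2 else 0.
Proof.
move=> m4; case: ifP => zm; last first.
  by apply/count_memPn/negP => /mem_cyc_word; rewrite zm => /(_ (ltnW (ltnW m4))).
apply/eqP; rewrite eqn_leq; apply/andP; split.
  rewrite leqNgt; apply/negP => /three_occurrences [a [b [c [d]]]].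
  exact: cyc_triple.
have [||a [b [c ->]]] := @cyc_word_twice m z; try lia.
by rewrite !count_cat /= count_cat /= eqxx; lia.
Qed.

Lemma cyc_embed k m s : 4 <= k -> 4 <= m -> k <> m ->
  infix (wsubst s (cyc_word k)) (cyc_word m) -> wsubst s (cyc_word k) = [::].
Proof.
move=> k4 m4 km /infixP [A [B E]].
have k2 : 2 <= k by lia.
(* As [x] occurs twice, an image of length two or more would repeat a factor of length two, against
   [cyc_pair]. *)
have short x : x < k -> size (s x) <= 1.
  move=> xk; have [a [b [c F]]] := cyc_word_twice k2 xk.
  case Es : (s x) => [|y [|z r]] //; exfalso.
  apply: (@cyc_pair m (A ++ wsubst s a) y z (r ++ wsubst s b) (r ++ wsubst s c ++ B)) => //.
  by rewrite E F !(wsubst_cat, wsubst_cons) Es /= -?catA /= -?catA /= -?catA.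
have gap x b a c y : cyc_word k = a ++ x :: b ++ x :: c -> s x = [:: y] ->
    size (wsubst s b) = 2 \/ size (wsubst s b) = m.*2 - 4.
  move=> F Es.
  apply: (@cyc_gap m (A ++ wsubst s a) y _ (wsubst s c ++ B)) => //.
  by rewrite E F !(wsubst_cat, wsubst_cons) Es /= -?catA /= -?catA /= -?catA.
have kept x : x < k -> s x <> [::] -> exists y, s x = [:: y].
  by move=> /short; case: (s x) => [|y [|]] // _ _; exists y.
(* Two images of length at most one must fill a gap of [2] or [2m-4 >= 4], so neither neighbour of a
   kept letter is erased. *)
have spread x : x < k.-1 -> s x <> [::] ->
    s (if x == 0 then k.-1 else x.-1) <> [::] /\ s x.+1 <> [::].
  move=> xk nx; have [a [c F]] := cyc_word_factor xk.
  have [|y Ey] := kept x _ nx; first by lia.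
  have := @gap x [:: _; _] a c y F Ey; rewrite /wsubst /= cats0 size_cat.
  have : size (s (if x == 0 then k.-1 else x.-1)) <= 1 by apply: short; case: ifP; lia.
  have : size (s x.+1) <= 1 by apply: short; lia.
  case: (s x.+1) => [|? ?]; case: (s (if _ then _ else _)) => [|? ?] //=; split => //; lia.
(* Keeping a letter below [k-1] keeps 0, through left neighbours; keeping 0 then keeps every letter,
   through right neighbours. *)
have zero x : x < k.-1 -> s x <> [::] -> s 0 <> [::].
  elim: x => // x ih xk nx; apply: ih; first by lia.
  by have [] := spread _ xk nx.
have up x : s 0 <> [::] -> x < k -> s x <> [::].
  move=> s0; elim: x => // x ih xk; have [||//] := spread x; first by lia.
  by apply: ih; lia.
have [b [F sb]] := cyc_word_last k2.
have F' : cyc_word k = [:: 0] ++ k.-1 :: b ++ k.-1 :: [:: k.-2] by rewrite F.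
have mem_b x : x \in b -> x < k.
  by move=> xb; apply: mem_cyc_word => //; rewrite F !inE mem_cat xb !orbT.
(* With 0 erased only [k-1] can survive, and the gap between its two images would be 0. *)
have [s0|s0] := eqVneq (s 0) [::].
  have low x : x < k.-1 -> s x = [::].
    by move=> xk; apply/eqP/negPn/negP => /eqP /zero; apply => //; rewrite s0.
  have [sk|/eqP sk] := eqVneq (s k.-1) [::].
    suff h u : (forall x, x \in u -> x < k) -> wsubst s u = [::].
      by apply: h => x; apply: mem_cyc_word.
    elim: u => // x u ih h; rewrite wsubst_cons ih => [|y yu]; last first.
      by apply: h; rewrite inE yu orbT.
    have : x < k by apply: h; rewrite mem_head.
    have [/low ->//|kx xk] := ltnP x k.-1.
    by have ->: x = k.-1; [lia | rewrite sk].
  have [|y Ey] := kept k.-1 _ sk; first by lia.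
  have lb x : x \in b -> s x = [::].
    move=> xb; have [/low //|kx] := ltnP x k.-1.
    have xk := mem_b x xb; have ex : x = k.-1 by lia.
    have := @cyc_count k x k4; rewrite F' xk /= eq_sym ex eqxx count_cat /= eqxx.
    have : 0 < count_mem k.-1 b by rewrite -has_count has_pred1 -ex.
    by case: (count_mem _ b) => // n _; rewrite -[nat_of_bool true]/1 !(addSn, addnS).
  have : wsubst s b = [::].
    elim: (b) lb => // x b' ih h; rewrite wsubst_cons h ?mem_head // ih // => z zb.
    by apply: h; rewrite inE zb orbT.
  by have := gap _ _ _ _ _ F' Ey => /[swap] -> /=; lia.
(* With nothing erased the gap [2k-4] of [k-1] is preserved, yet it is neither [2] nor [2m-4]. *)
exfalso; have sizes u : (forall x, x \in u -> x < k) -> size (wsubst s u) = size u.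
  elim: u => // x u ih h; rewrite wsubst_cons size_cat ih => [|y yu]; last first.
    by apply: h; rewrite inE yu orbT.
  have [||y ->//] := kept x; first by apply: h; rewrite mem_head.
  by apply: up; [apply/eqP | apply: h; rewrite mem_head].
have [||y Ey] := kept k.-1; first by lia.
  by apply: up; [apply/eqP | lia].
by have := gap _ _ _ _ _ F' Ey; rewrite sizes // sb; lia.
Qed.

Lemma cyc_mate m i j : 4 <= m -> i < m.*2 -> j < m.*2 -> i <> j ->
  cyc_letter m i = cyc_letter m j ->
  [\/ i = 1 /\ j = m.*2 - 2, j = 1 /\ i = m.*2 - 2,
      ~~ odd i /\ j = i + 3 | odd i /\ i = j + 3].
Proof.
move=> m4 im jm ij E.
case: (cyc_letterP (erefl (cyc_letter m i))); case: (cyc_letterP E) => *;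
  try (by exfalso; lia); by [apply: Or41; lia | apply: Or42; lia |
   apply: Or43; lia | apply: Or44; lia].
Qed.

(* Equivalently, the parities of letter counts in the prefixes of cyc_word m
   trace a walk in a hypercube that revisits no vertex before its end. *)
Lemma cyc_word_even_factor m w t y r : 4 <= m ->
  cyc_word m = w ++ t ++ y :: r -> (forall z, ~~ odd (count_mem z t)) -> t = [::].
Proof.
move=> m4 E ev_t.
have sz : (size w + size t).+1 <= m.*2.
  by rewrite -(size_cyc_word m) E !size_cat /=; lia.
have mate k : size w <= k < size w + size t ->
    exists k', [/\ size w <= k' < size w + size t, k <> k' & cyc_letter m k = cyc_letter m k'].
  move=> kt; pose x := nth 0 t (k - size w).
  have h2 : k - size w < size t by lia.
  have kx : cyc_letter m k = x.
    rewrite -nth_cyc_word; last by lia.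
    have h1 : (k < size w) = false by lia.
    by rewrite E nth_cat h1 nth_cat h2.
  have xt : x \in t by apply: mem_nth.
  have : 1 < count_mem x t.
    have := ev_t x; have : 0 < count_mem x t by rewrite -has_count has_pred1.
    by case: (count_mem x t) => [|[|]].
  move=> /two_occurrences [a [b [c F]]].
  have E1 : cyc_word m = (w ++ a) ++ x :: b ++ x :: c ++ y :: r.
    by rewrite E F -!catA /= -!catA.
  have E2 : cyc_word m = (w ++ a ++ x :: b) ++ x :: c ++ y :: r.
    by rewrite E F -!catA /= -!catA.
  have [k1 _] := cyc_letter_split E1; have [k2 _] := cyc_letter_split E2.
  have st := congr1 size F; move: k1 k2 st; rewrite !size_cat /= size_cat /= => k1 k2 st.
  have [ka|/eqP ka] := eqVneq k (size w + size a).
    exists (size w + (size a + (size b).+1)); rewrite kx -k2; split => //; lia.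
  exists (size w + size a); rewrite kx -k1; split => //; lia.
have [//|t0] := eqVneq t [::]; exfalso; move: t0; rewrite -size_eq0 => t0.
have {}mate k : size w <= k < size w + size t ->
    [\/ k = 1 /\ m.*2 - 2 < size w + size t, k = m.*2 - 2 /\ size w <= 1,
       ~~ odd k /\ k + 3 < size w + size t | odd k /\ size w + 3 <= k].
  move=> kt; have [k' [kt' kk' E']] := mate k kt.
  have km : k < m.*2 by lia.
  have km' : k' < m.*2 by lia.
  have [[? ?]|[? ?]|[? ?]|[? ?]] := cyc_mate m4 km km' kk' E'.
  - by apply: Or41; lia.
  - by apply: Or42; lia.
  - by apply: Or43; lia.
  - by apply: Or44; lia.
(* Some partner falls outside [t]. From start 0, the partners of 0, 1 and [2m-4] lead to the last
   position [2m-1], which [t] misses because [y] follows it. From start 1, position 3 has partner 0.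
   From a later start [i], the odd one of [i], [i+1] has its partner before the start. *)
move: (size w) (size t) sz t0 mate => i l sz l0 mate.
have [i0|i0] := eqVneq i 0.
  case: (mate 0) => [|[? ?]|[? ?]|[? ?]|[? ?]]; try lia.
  case: (mate 1) => [|[? ?]|[? ?]|[? ?]|[? ?]]; try lia.
  by case: (mate (m.*2 - 4)) => [|[? ?]|[? ?]|[? ?]|[? ?]]; lia.
have [i1|i1] := eqVneq i 1.
  case: (mate 1) => [|[? ?]|[? ?]|[? ?]|[? ?]]; try lia.
  by case: (mate 3) => [|[? ?]|[? ?]|[? ?]|[? ?]]; lia.
case: (mate i) => [|[? ?]|[? ?]|[? ?]|[? ?]]; try lia.
by case: (mate i.+1) => [|[? ?]|[? ?]|[? ?]|[? ?]]; lia.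
Qed.

(** * Restriction of words to two letters *)

Section BoolWords.
Variables x y : nat.

(** If no letter occurs more than twice, these restrictions have length at most 4, so statements
    about them can be checked by enumeration. *)
Definition bool_word (u : seq nat) : seq bool :=
  [seq z == x | z <- u & (z == x) || (z == y)].

Definition bool_letter (b : bool) : nat := if b then x else y.

Lemma bool_word_cat u v : bool_word (u ++ v) = bool_word u ++ bool_word v.
Proof. by rewrite /bool_word filter_cat map_cat. Qed.

Lemma bool_word_x u : bool_word (x :: u) = true :: bool_word u.
Proof. by rewrite /bool_word /= eqxx /= eqxx. Qed.

Hypothesis xy : x != y.

Lemma bool_word_y u : bool_word (y :: u) = false :: bool_word u.
Proof. by rewrite /bool_word /= eqxx orbT /= (eq_sym y) (negPf xy). Qed.

Lemma count_bool_word_true u : count_mem true (bool_word u) = count_mem x u.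
Proof.
elim: u => // z u ih; rewrite /bool_word /=.
case: (eqVneq z x) => [->|zx] /=; first by rewrite eqxx -ih.
by case: ifP => _ /=; rewrite ?(negPf zx) -ih.
Qed.

Lemma count_bool_word_false u : count_mem false (bool_word u) = count_mem y u.
Proof.
elim: u => // z u ih; rewrite /bool_word /=.
case: (eqVneq z x) => [->|zx] /=; first by rewrite eqxx (negPf xy) -ih.
by case: ifP => zy /=; rewrite ?zy ?(negPf zx) -ih.
Qed.

Lemma map_bool_word u :
  map bool_letter (bool_word u) = filter (fun z => (z == x) || (z == y)) u.
Proof.
rewrite /bool_word -map_comp -[RHS]map_id; apply/eq_in_map => z.
by rewrite mem_filter /= /bool_letter => /andP[/orP[/eqP->|/eqP->] _];
  rewrite ?eqxx // (eq_sym y) (negPf xy).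
Qed.

Lemma ev_bool_word (M : monoidType) (g : bool -> M) u :
  ev (fun z => if z == x then g true else if z == y then g false else 1%g) u
  = (\prod_(b <- bool_word u) g b)%g.
Proof.
elim: u => [|z u ih]; first by rewrite !big_nil.
rewrite big_cons ih; have [->|zx] := eqVneq z x.
  by rewrite bool_word_x big_cons.
have [->|zy] := eqVneq z y; first by rewrite bool_word_y big_cons.
by rewrite /bool_word /= (negPf zx) (negPf zy) mul1g.
Qed.

End BoolWords.

(** Restricting to the two first letters shows that they coincide, and a common first letter cancels
    in every restriction. Against an empty word any second letter serves, here the successor. *)
Lemma eq_bool_word u v :
  (forall x y, x != y -> bool_word x y u = bool_word x y v) -> u = v.
Proof.
elim: u v => [|x u ih] [|y v] // h.
- have /(h y) : y != y.+1 by rewrite neq_ltn leqnn.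
  by rewrite bool_word_x.
- have /(h x) : x != x.+1 by rewrite neq_ltn leqnn.
  by rewrite bool_word_x.
have [exy|xy] := eqVneq x y; last first.
  by have := h x y xy; rewrite bool_word_x bool_word_y.
subst y; congr (_ :: _); apply: ih => z t zt.
have := h z t zt; rewrite -[x :: u]cat1s -[x :: v]cat1s !bool_word_cat.
by move=> /eqP; rewrite eqseq_cat // => /andP[_ /eqP].
Qed.

Fixpoint bool_words (n : nat) : seq (seq bool) :=
  if n is n'.+1 then
    [::] :: flatten [seq [:: true :: s; false :: s] | s <- bool_words n']
  else [:: [::]].

Lemma mem_bool_words n s : size s <= n -> s \in bool_words n.
Proof.
elim: n s => [|n ih] [|b s] //= sn.
rewrite inE; apply/flattenP; exists [:: true :: s; false :: s].
  by apply/mapP; exists s => //; apply: ih.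
by rewrite !inE; case: b; rewrite eqxx ?orbT.
Qed.

Lemma size_bool_word (s : seq bool) : size s = count_mem true s + count_mem false s.
Proof. by elim: s => //= -[] s ->; rewrite ?addSn ?addnS. Qed.

End CyclicWords.

(** * The variety generated by L_2^1, A_0^1 and R_2^1 *)

Definition LAR (M : monoidType) : Prop :=
  M = adjoin1 L2 \/ M = adjoin1 A0 \/ M = adjoin1 R2.

Lemma big_foldr (M : monoidType) (g : bool -> M) s :
  \prod_(b <- s) g b = foldr (fun b c => g b * c) 1 s.
Proof. by elim: s => [|b s ih]; rewrite ?big_nil // big_cons ih. Qed.

Definition agree_on (M : monoidType) (t f : M) (U V : seq bool) : bool :=
  let ev := foldr (fun b c => (if b then t else f) * c) 1 in ev U == ev V.

(** [L_2^1] and [R_2^1] reveal the first and the last letter; [A_0^1] at its generators reveals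
    whether all occurrences of one letter precede those of the other, and at [ba] whether a letter
    occurs 0, 1 or more times. *)
Definition LAR_agree (U V : seq bool) : bool :=
  [&& agree_on (Some L2a : adjoin1 L2) (Some L2b) U V,
      agree_on (Some R2a : adjoin1 R2) (Some R2b) U V,
      agree_on (Some A0a : adjoin1 A0) (Some A0b) U V,
      agree_on (Some A0b : adjoin1 A0) (Some A0a) U V,
      agree_on (Some A0ba : adjoin1 A0) None U V &
      agree_on (None : adjoin1 A0) (Some A0ba) U V].

Definition limited (u : seq nat) : Prop := forall z, (count_mem z u <= 2)%N.

Definition limitedb (U : seq bool) : bool :=
  (count_mem true U <= 2)%N && (count_mem false U <= 2)%N.

Lemma LAR_agree_check :
  all (fun U => all (fun V => (limitedb U && limitedb V && LAR_agree U V) ==> (U == V))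
    (bool_words 4)) (bool_words 4).
Proof. by vm_compute. Qed.

Lemma limited_bool_word x y u : x != y -> limited u -> limitedb (bool_word x y u).
Proof.
by move=> xy lu; rewrite /limitedb count_bool_word_true ?count_bool_word_false // !lu.
Qed.

Lemma limitedb_size U : limitedb U -> (size U <= 4)%N.
Proof. by case/andP => a b; rewrite size_bool_word; lia. Qed.

Lemma satisfies_bool_word (M : monoidType) u v x y (g : bool -> M) : x != y ->
  satisfies M (u, v) ->
  \prod_(b <- bool_word x y u) g b = \prod_(b <- bool_word x y v) g b.
Proof. by move=> xy h; rewrite -!ev_bool_word //; apply: h. Qed.

Lemma satisfies_agree (M : monoidType) u v x y (t f : M) : x != y ->
  satisfies M (u, v) -> agree_on t f (bool_word x y u) (bool_word x y v).
Proof.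
move=> xy /(satisfies_bool_word (fun b => if b then t else f) xy).
by rewrite !big_foldr => E; apply/eqP.
Qed.

Lemma LAR_limited u v : limited u -> limited v -> holds LAR (u, v) -> u = v.
Proof.
move=> lu lv h; apply: eq_bool_word => x y xy.
have hL : satisfies (adjoin1 L2) (u, v) by apply: h; left.
have hA : satisfies (adjoin1 A0) (u, v) by apply: h; right; left.
have hR : satisfies (adjoin1 R2) (u, v) by apply: h; right; right.
have LU := limited_bool_word xy lu; have LV := limited_bool_word xy lv.
have /allP /(_ _ (mem_bool_words (limitedb_size LU)))
  /allP /(_ _ (mem_bool_words (limitedb_size LV))) := LAR_agree_check.
rewrite LU LV /= => /implyP /(_ _) /eqP; apply.
by rewrite /LAR_agree !satisfies_agree.
Qed.

Definition middle_identity : identity := ([:: 0; 1; 0; 2; 0], [:: 0; 1; 2; 0])%N.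

Lemma LAR_middle : holds LAR middle_identity.
Proof.
move=> M [->|[->|->]] f; rewrite /= !big_cons !big_nil.
- by case: (f 0%N) => [[]|]; case: (f 1%N) => [[]|]; case: (f 2%N) => [[]|].
- by case: (f 0%N) => [[]|]; case: (f 1%N) => [[]|]; case: (f 2%N) => [[]|].
- by case: (f 0%N) => [[]|]; case: (f 1%N) => [[]|]; case: (f 2%N) => [[]|].
Qed.

(** * Deleting middle occurrences of a letter *)

Section Middle.
Variable M : monoidType.
Hypothesis Mmid : satisfies M middle_identity.

Lemma middle_mul (a b c : M) : a * b * a * c * a = a * b * c * a.
Proof.
have := Mmid (fun i => if i == 0%N then a else if i == 1%N then b else c).
by rewrite /= !big_cons !big_nil /= !mulg1 !mulgA.
Qed.

Lemma ev_middle (f : nat -> M) p x q : x \in p -> x \in q ->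
  ev f (p ++ x :: q) = ev f (p ++ q).
Proof.
case/splitPr => p1 p2; case/splitPr => q1 q2.
rewrite !(big_cat, big_cons) /= !mulgA; congr (_ * _).
have := middle_mul (f x) (ev f p2) (ev f q1); rewrite -!mulgA => E.
by rewrite E.
Qed.

(* A and B hold letters known to occur to the left and to the right of s. *)
Fixpoint reduce (A B s : seq bool) : seq bool :=
  if s is z :: s' then
    if (z \in A) && ((z \in s') || (z \in B)) then reduce A B s'
    else z :: reduce (z :: A) B s'
  else [::].

Lemma ev_reduce (f : nat -> M) (h : bool -> nat) A B s p q :
  (forall b, b \in A -> h b \in p) -> (forall b, b \in B -> h b \in q) ->
  ev f (p ++ map h s ++ q) = ev f (p ++ map h (reduce A B s) ++ q).
Proof.
move=> Ap Bq; elim: s A p Ap => //= z s ih A p Ap; case: ifP => [/andP[zA zsB]|_].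
  rewrite -ih // ev_middle ?Ap // mem_cat.
  by case/orP: zsB => [zs|/Bq ->]; rewrite ?orbT ?(map_f h zs).
rewrite /= -!cat_rcons; apply: ih => b; rewrite inE mem_rcons inE.
by case/orP => [/eqP ->|/Ap ->]; rewrite ?eqxx ?orbT.
Qed.

End Middle.

(* U and V are the restrictions to x = true and y = false of the two words in
   swap_adjacent. *)
Definition swap_checkb (W S Q V2 : seq bool) : bool :=
  let P := W ++ S in let U := P ++ [:: true, false & Q] in let V := W ++ false :: V2 in
  [&& false \notin S, limitedb U, count_mem true U == count_mem true V &
      count_mem false U == count_mem false V] ==>
  (reduce P Q (P ++ U ++ Q) == [:: true; false]) &&
  (reduce P Q (P ++ V ++ Q) == [:: false; true]).

Lemma swap_check : all (fun W => all (fun S => all (fun Q => all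
    (swap_checkb W S Q) (bool_words 3)) (bool_words 2)) (bool_words 2)) (bool_words 2).
Proof. by vm_compute. Qed.

Definition agree (M : monoidType) (u v : seq nat) : Prop :=
  forall x y, x != y -> forall g : bool -> M,
    \prod_(b <- bool_word x y u) g b = \prod_(b <- bool_word x y v) g b.

Lemma perm_limited u v : perm_eq u v -> limited u -> limited v.
Proof. by move=> /seq.permP uv lu z; rewrite -uv. Qed.

(** * Sorting one side of an identity into the other *)

Section Sorting.
Variable M : monoidType.
Hypothesis Mmid : satisfies M middle_identity.

(** Between [w ++ s] and [q], insert the restriction of either word, framed by those of [w ++ s] and
    [q]. Deleting middle occurrences collapses the first insertion to [x y] and the second to [y x],
    while the two restrictions have equal values in [M]. *)
Lemma swap_adjacent w s x y q v : x != y -> y \notin s ->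
  limited (w ++ s ++ [:: x, y & q]) ->
  perm_eq (w ++ s ++ [:: x, y & q]) (w ++ y :: v) ->
  agree M (w ++ s ++ [:: x, y & q]) (w ++ y :: v) ->
  satisfies M (w ++ s ++ [:: x, y & q], w ++ s ++ [:: y, x & q]).
Proof.
set u := w ++ s ++ _; move=> xy ys lu uv ag f.
pose B := bool_word x y; pose h := bool_letter x y.
have BU : B u = (B w ++ B s) ++ [:: true, false & B q].
  by rewrite /B /u !bool_word_cat -[[:: x, y & q]]/([:: x] ++ y :: q)
    bool_word_cat bool_word_x bool_word_y // -!catA.
have BV : B (w ++ y :: v) = B w ++ false :: B v.
  by rewrite /B bool_word_cat bool_word_y.
have lU := limited_bool_word xy lu; rewrite -/B in lU.
have c1 : count_mem true (B u) = count_mem true (B (w ++ y :: v)).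
  by rewrite /B !count_bool_word_true //; apply/seq.permP.
have c2 : count_mem false (B u) = count_mem false (B (w ++ y :: v)).
  by rewrite /B !count_bool_word_false //; apply/seq.permP.
have szU := limitedb_size lU.
have szV : (size (B (w ++ y :: v)) <= 4)%N.
  by rewrite size_bool_word -c1 -c2 -size_bool_word.
move: szU szV; rewrite BU BV !size_cat /= => szU szV.
have fS : false \notin B s.
  by rewrite -has_pred1 has_count /B count_bool_word_false // -has_count has_pred1.
have /allP /(_ (B w)) H := swap_check.
have {H} /allP /(_ (B s)) H : _ := H (mem_bool_words (ltac:(lia) : (size (B w) <= 2)%N)).
have {H} /allP /(_ (B q)) H : _ := H (mem_bool_words (ltac:(lia) : (size (B s) <= 2)%N)).
have {H} /allP /(_ (B v)) H : _ := H (mem_bool_words (ltac:(lia) : (size (B q) <= 2)%N)).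
have {H} := H (mem_bool_words (ltac:(lia) : (size (B v) <= 3)%N)).
rewrite /swap_checkb fS -BU -BV lU c1 c2 !eqxx /= => /andP[/eqP rU /eqP rV].
have hP b : b \in B w ++ B s -> h b \in w ++ s.
  rewrite -bool_word_cat => bin.
  have : h b \in map h (B (w ++ s)) by apply: map_f.
  by rewrite map_bool_word // mem_filter => /andP[].
have hQ b : b \in B q -> h b \in q.
  move=> bin; have : h b \in map h (B q) by apply: map_f.
  by rewrite map_bool_word // mem_filter => /andP[].
have evh t : ev f (map h t) = \prod_(b <- t) f (h b) by rewrite big_map.
have E U a b : reduce (B w ++ B s) (B q) ((B w ++ B s) ++ U ++ B q) = [:: a; b] ->
    ev f (w ++ s ++ [:: h a, h b & q]) = ev f (w ++ s) *
      (ev f (map h (B w ++ B s)) * \prod_(b <- U) f (h b) * ev f (map h (B q))) * ev f q.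
  move=> r; have := ev_reduce Mmid f ((B w ++ B s) ++ U ++ B q) hP hQ.
  rewrite r /= => Q0; rewrite [w ++ s ++ _]catA -Q0.
  by rewrite !map_cat !big_cat /= !evh !mulgA.
by have := E _ _ _ rU; have := E _ _ _ rV; rewrite /h /bool_letter /= => -> ->; rewrite ag.
Qed.

Lemma agree_trans_l u u' v : satisfies M (u, u') -> agree M u v -> agree M u' v.
Proof. by move=> uu' ag x y xy g; rewrite -ag // (satisfies_bool_word _ xy uu'). Qed.

(** [y] passes the letters of [s] one by one, the last first; each transposition holds in [M], so
    agreement with the target word is kept. *)
Lemma move_left w s y q v : y \notin s ->
  limited (w ++ s ++ y :: q) -> perm_eq (w ++ s ++ y :: q) (w ++ y :: v) ->
  agree M (w ++ s ++ y :: q) (w ++ y :: v) ->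
  satisfies M (w ++ s ++ y :: q, w ++ y :: s ++ q).
Proof.
elim/last_ind: s q => [//|s x ih] q.
rewrite mem_rcons inE negb_or cat_rcons => /andP[yx ys] lu uv ag.
have xy : x != y by rewrite eq_sym.
have sw := swap_adjacent xy ys lu uv ag.
have pm : perm_eq (w ++ s ++ [:: x, y & q]) (w ++ s ++ [:: y, x & q]).
  by rewrite !perm_cat2l; apply/seq.permP => p /=; rewrite addnCA.
have := ih (x :: q) ys; rewrite cat_rcons => {}ih f.
rewrite (sw f); apply: ih.
- exact: perm_limited pm lu.
- by rewrite perm_sym in pm; apply: perm_trans pm uv.
- exact: agree_trans_l sw ag.
Qed.

(** Insertion sort: behind the common prefix [w], the first occurrence of the next letter of [v] is
    moved to the front and joins the prefix. *)
Lemma agree_satisfies u v : limited u -> perm_eq u v -> agree M u v -> satisfies M (u, v).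
Proof.
rewrite -[u]/([::] ++ u) -[v]/([::] ++ v); move: [::] => w.
elim: v w u => [|y v ih] w u lu uv ag.
  by move: uv; rewrite perm_cat2l => /perm_nilP ->.
have yu : y \in u by move: uv; rewrite perm_cat2l => /perm_mem ->; rewrite mem_head.
have [s [q [E ys]]] : exists s q, u = s ++ y :: q /\ y \notin s.
  exists (take (index y u) u), (drop (index y u).+1 u); split.
    have iu : (index y u < size u)%N by rewrite index_mem.
    by rewrite {1}(drop_cons2 iu) nth_index.
  by rewrite in_take ?ltnn.
subst u; have mv := move_left ys lu uv ag.
have pm : perm_eq (w ++ s ++ y :: q) (w ++ y :: s ++ q).
  by rewrite perm_cat2l perm_catC /= perm_cons perm_catC.
move=> f; rewrite (mv f) -!cat_rcons; apply: ih; rewrite !cat_rcons.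
- exact: perm_limited pm lu.
- by rewrite perm_sym in pm; apply: perm_trans pm uv.
- exact: agree_trans_l mv ag.
Qed.

End Sorting.

(** As long as some letter occurs three times, one of its middle occurrences is deleted. The reduct
    does not depend on [M]. *)
Lemma limited_reduct u : exists u', (forall z, count_mem z u' = minn 2 (count_mem z u)) /\
  forall M, satisfies M middle_identity -> satisfies M (u, u').
Proof.
have [n] := ubnP (size u); elim: n u => // n ih u un.
have [lu|/existsNP [x /negP]] := pselect (limited u).
  by exists u; split=> // z; apply/esym/minn_idPr/lu.
rewrite -ltnNge => /three_occurrences [a [b [c [d E]]]].
have E' : u = (a ++ x :: b) ++ x :: c ++ x :: d by rewrite E -catA.
have [|u' [cu' su']] := ih ((a ++ x :: b) ++ c ++ x :: d).
  by move: un; rewrite E' !size_cat /= !size_cat /=; lia.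
exists u'; split=> [z|M Mmid f].
  rewrite cu' E' !count_cat /= !count_cat /=; case: eqP => _; lia.
rewrite -(su' M Mmid f) /= E' ev_middle // ?mem_cat ?mem_head ?orbT //.
Qed.

Lemma models_middle (M : monoidType) e :
  satisfies M middle_identity -> holds LAR e -> satisfies M e.
Proof.
case: e => u v Mmid uv.
have [u' [cu uu']] := limited_reduct u; have [v' [cv vv']] := limited_reduct v.
have E : u' = v'.
  apply: LAR_limited => [z|z|N KN f]; rewrite ?cu ?cv ?geq_minl //.
  have Nmid := LAR_middle KN.
  by rewrite -(uu' N Nmid f) -(vv' N Nmid f) (uv N KN).
by move=> f; rewrite (uu' M Mmid f) E -(vv' M Mmid f).
Qed.

Lemma models_theory_LAR : models (theory LAR) = models [set middle_identity]%classic.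
Proof.
apply/funext => M; apply/propext; split=> [h e ->|h e he].
  by apply: h => N /LAR_middle.
by apply: models_middle he; apply: h.
Qed.

(** * Subvarieties of the variety generated by L_2^1, A_0^1 and R_2^1 *)

Definition nat_letter (b : bool) : nat := if b then 0%N else 1%N.

Definition two_letter_identities : seq identity :=
  [seq (map nat_letter U, map nat_letter V) | U <- bool_words 4, V <- bool_words 4].

Lemma two_letter_mem U V : limitedb U -> limitedb V ->
  (map nat_letter U, map nat_letter V) \in two_letter_identities.
Proof.
by move=> lU lV; apply: allpairs_f; apply: mem_bool_words; apply: limitedb_size.
Qed.

Lemma ev_nat_letter (M : monoidType) (f : nat -> M) s :
  ev f (map nat_letter s) = \prod_(b <- s) f (nat_letter b).
Proof. by rewrite big_map. Qed.

Section SmallLAR.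
Variables (W : monoidClass) (M : monoidType).
Hypothesis WU : subclass W (variety_generated LAR).
Hypothesis Mmid : satisfies M middle_identity.
Hypothesis WM : forall l, l \in two_letter_identities -> holds W l -> satisfies M l.

Lemma holds_middle : holds W middle_identity.
Proof. by move=> N /WU; apply: (holds_variety_generated _ _).2; exact: LAR_middle. Qed.

Lemma agree_of_holds u v : limited u -> limited v -> holds W (u, v) -> agree M u v.
Proof.
move=> lu lv h x y xy g.
have := WM (two_letter_mem (limited_bool_word xy lu) (limited_bool_word xy lv)) _.
move=> /(_ _ (fun i => if i == 0%N then g true else g false)) /=.
rewrite !ev_nat_letter.
have E (s : seq bool) : \prod_(b <- s) (if nat_letter b == 0%N then g true else g false) =
   \prod_(b <- s) g b by apply: eq_bigr => -[].
rewrite !E; apply => N WN f /=; rewrite !ev_nat_letter.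
exact: satisfies_bool_word xy (h N WN).
Qed.

Lemma pow_of_holds u v z (c : M) : limited u -> limited v -> holds W (u, v) ->
  c ^+ count_mem z u = c ^+ count_mem z v.
Proof.
move=> lu lv h; have zz : z != z.+1 by rewrite neq_ltn leqnn.
have E w : \prod_(b <- bool_word z z.+1 w) (if b then c else 1) = c ^+ count_mem z w.
  rewrite -(ev_bool_word zz (fun b => if b then c else 1)) -ev_single.
  by apply: eq_bigr => i _; case: ifP => //; case: ifP.
by rewrite -!E; apply: agree_of_holds h _ _ zz _.
Qed.

(** If the reducts have equal letter counts, sorting applies. Otherwise [M] is trivial or
    idempotent, and in the latter case doubling all letters equalises the counts. *)
Lemma satisfies_of_holds u v : holds W (u, v) -> satisfies M (u, v).
Proof.
have [u' [cu uu']] := limited_reduct u; have [v' [cv vv']] := limited_reduct v.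
move=> huv.
have lu : limited u' by move=> z; rewrite cu geq_minl.
have lv : limited v' by move=> z; rewrite cv geq_minl.
have {}huv : holds W (u', v').
  move=> N WN f; have Nmid := holds_middle WN.
  by rewrite -(uu' N Nmid f) -(vv' N Nmid f) /= (huv N WN).
suff uv' : satisfies M (u', v').
  by move=> f; rewrite (uu' M Mmid f) /= (uv' f) -(vv' M Mmid f).
have [eq_count|] := pselect (forall z, count_mem z u' = count_mem z v').
  apply: agree_satisfies => //; last exact: agree_of_holds.
  by apply/allP => z _ /=; apply/eqP/eq_count.
move=> /existsNP [z nz].
have [triv|ntriv] := pselect (forall c : M, c = 1).
  by move=> f /=; rewrite (triv (ev f u')) (triv (ev f v')).
(* The middle identity with [y = z = 1] reads [c^3 = c^2], so [c^2 = 1] gives [c = 1]. *)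
have unit0 (c : M) k : (0 < k <= 2)%N -> c ^+ k = 1 -> c = 1.
  case: k => [|[|[|]]] //= _; rewrite ?expg1 // expg2 => cc.
  by have := middle_mul Mmid c 1 1; rewrite !mulg1 cc mul1g.
(* A letter occurring on one side only forces M to be trivial. *)
have content t : (count_mem t u' == 0%N) = (count_mem t v' == 0%N).
  apply/idP/idP => /eqP t0; apply/negPn/negP => t1; apply: ntriv => c.
    apply: (unit0 c (count_mem t v')); first by rewrite lv lt0n t1.
    by rewrite -(pow_of_holds t c lu lv huv) t0 expg0.
  apply: (unit0 c (count_mem t u')); first by rewrite lu lt0n t1.
  by rewrite (pow_of_holds t c lu lv huv) t0 expg0.
(* The counts of [z] differ, are both nonzero and at most 2, so they are 1 and 2. *)
have idem (c : M) : c * c = c.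
  have := pow_of_holds z c lu lv huv; have := content z; have := lu z; have := lv z.
  case: (count_mem z u') nz => [|[|[|k]]]; case: (count_mem z v') => [|[|[|l]]] //= _ _ _ _;
    by rewrite expg1 expg2.
pose dbl w := wsubst (fun i => [:: i; i]) w.
have count_dbl t w : count_mem t (dbl w) = (count_mem t w).*2.
  by elim: w => //= i w ih; rewrite ih; case: (i == t); rewrite /= ?addn0 // doubleS !addSn.
have ev_dbl w f : ev f (dbl w) = ev f w :> M.
  by rewrite ev_wsubst; apply: eq_bigr => i _; rewrite !big_cons big_nil mulg1 idem.
have [a [ca ua]] := limited_reduct (dbl u'); have [b [cb vb]] := limited_reduct (dbl v').
have la : limited a by move=> t; rewrite ca geq_minl.
have lb : limited b by move=> t; rewrite cb geq_minl.
have hab : holds W (a, b).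
  move=> N WN f; have Nmid := holds_middle WN.
  rewrite -(ua N Nmid f) -(vb N Nmid f) /=.
  exact: (satisfies_wsubst _ (huv N WN)).
move=> f; rewrite /= -(ev_dbl u') -(ev_dbl v') (ua M Mmid f) (vb M Mmid f) /=.
apply: agree_satisfies => //; last exact: agree_of_holds.
apply/allP => t _ /=; rewrite ca cb !count_dbl; have := content t.
by case: (count_mem t u') => [|k]; case: (count_mem t v') => [|l] // _;
  rewrite !doubleS !minnSS !min0n.
Qed.

End SmallLAR.

Lemma small_LAR : small (variety_generated LAR).
Proof.
apply: (@small_of_seq _ two_letter_identities) => W M [u v] WU UM huv WM.
apply: (satisfies_of_holds WU) => //; move: UM.
by rewrite variety_generatedE models_theory_LAR; apply.
Qed.

Lemma satisfies_prod (M N : monoidType) e :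
  satisfies (M * N)%type e <-> satisfies M e /\ satisfies N e.
Proof.
have E (f : nat -> M * N) u : ev f u = (ev (fun i => (f i).1) u, ev (fun i => (f i).2) u).
  by elim: u => [|i u ih]; rewrite ?big_nil // !big_cons ih.
split=> [h|[hM hN] f]; last by rewrite !E; congr pair; [apply: hM | apply: hN].
split=> f.
  by have := congr1 fst (h (fun i => (f i, 1))); rewrite !E.
by have := congr1 snd (h (fun i => (1, f i))); rewrite !E.
Qed.

Lemma variety_generated_eq (K K' : monoidClass) :
  (forall e, holds K e <-> holds K' e) -> variety_generated K = variety_generated K'.
Proof.
move=> h; rewrite !variety_generatedE; congr models.
by apply/funext => e; apply/propext.
Qed.

Lemma Cross_LAR : Cross (variety_generated LAR).
Proof.
split.
- exact: is_variety_generated.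
- exists [set middle_identity]%classic; split; first exact: finite_set1.
  by rewrite variety_generatedE models_theory_LAR.
(* A product satisfies exactly the identities common to its factors, so it serves as a single finite
   generator. *)
- exists ((adjoin1 L2 * adjoin1 A0)%type * adjoin1 R2)%type; split.
    exact: (@finite_finset ((option L2 * option A0) * option R2)%type).
  apply: variety_generated_eq => e; split=> h M.
    move=> ->; apply/satisfies_prod; split; last by apply: h; right; right.
    by apply/satisfies_prod; split; apply: h; [left | right; left].
  have [/satisfies_prod[h1 h2] h3] := (satisfies_prod _ _ _).1 (h _ erefl).
  by case=> [->|[->|->]].
- exact: small_LAR.
Qed.

(** * The variety generated by M(x^2) *)

Definition comm_identity : identity := ([:: 0; 1], [:: 1; 0])%N.
Definition cube_identity : identity := ([:: 0; 0; 0], [:: 0; 0; 0; 0])%N.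

Definition isMxx (M : monoidType) : Prop := M = Mxx.

Lemma Mxx_pow n : (Mxx_x : Mxx) ^+ n =
  match n with 0 => Mxx_one | 1 => Mxx_x | 2 => Mxx_xx | _ => Mxx_zero end.
Proof. by elim: n => [|n ih]; rewrite ?expg0 // expgS ih; case: n {ih} => [|[|[|n]]]. Qed.

Lemma Mxx_count u v x : satisfies Mxx (u, v) ->
  minn 3 (count_mem x u) = minn 3 (count_mem x v).
Proof.
move=> /(@satisfies_pow _ _ _ x) /(_ (Mxx_x : Mxx)); rewrite !Mxx_pow.
by case: (count_mem x u) => [|[|[|k]]]; case: (count_mem x v) => [|[|[|l]]] //;
  rewrite !minnSS !min0n.
Qed.

Lemma commP (M : monoidType) :
  satisfies M comm_identity <-> forall a b : M, commute a b.
Proof.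
split=> [h a b|h f]; last by rewrite /= !big_cons !big_nil !mulg1; apply: h.
have := h (fun i => if i == 0%N then a else b).
by rewrite /= !big_cons !big_nil /= !mulg1 => E; exact: E.
Qed.

Lemma cubeP (M : monoidType) : satisfies M cube_identity ->
  forall (a : M) n, a ^+ n = a ^+ minn 3 n.
Proof.
move=> h a n; have a34 : a ^+ 4 = a ^+ 3.
  by have := h (fun=> a); rewrite /= !big_cons !big_nil /= !mulg1 => E; exact/esym.
elim: n => [|n ih]; rewrite ?minn0 // expgSr ih -expgSr.
by case: n {ih} => [|[|[|n]]] //; rewrite !minnSS !min0n.
Qed.

Lemma Mxx_comm_cube : satisfies Mxx comm_identity /\ satisfies Mxx cube_identity.
Proof.
split; first by apply/commP => -[] [].
by move=> f; rewrite /= !big_cons big_nil; case: (f 0%N).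
Qed.

Lemma commutative_satisfies (M : monoidType) u v :
  satisfies M comm_identity ->
  (forall (a : M) x, a ^+ count_mem x u = a ^+ count_mem x v) -> satisfies M (u, v).
Proof.
move=> /commP MC h f /=; have [n [un vn]] := word_bound u v.
by rewrite (ev_commute _ un) // (ev_commute _ vn) //; apply: eq_bigr => i _; apply: h.
Qed.

Definition power_identities n : seq identity :=
  [seq (nseq i 0%N, nseq j 0%N) | i <- iota 0 n, j <- iota 0 n].

Lemma mem_power_identities n i j : (i < n)%N -> (j < n)%N ->
  (nseq i 0%N, nseq j 0%N) \in power_identities n.
Proof. by move=> *; apply: allpairs_f; rewrite mem_iota. Qed.

Lemma satisfies_powers (M : monoidType) i j :
  satisfies M (nseq i 0%N, nseq j 0%N) <-> forall a : M, a ^+ i = a ^+ j.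
Proof.
split=> [h a|h f]; last by rewrite /= !ev_nseq.
by have := h (fun=> a); rewrite /= !ev_nseq.
Qed.

Lemma models_theory_Mxx :
  models (theory isMxx) = models [set comm_identity; cube_identity]%classic.
Proof.
have [h1 h2] := Mxx_comm_cube.
apply/funext => M; apply/propext; split=> [h e [->|->]|h [u v] huv].
- by apply: h => N ->.
- by apply: h => N ->.
have Mc : satisfies M comm_identity by apply: h; left.
have M3 : satisfies M cube_identity by apply: h; right.
apply: commutative_satisfies => // a x.
by rewrite (cubeP M3) [RHS](cubeP M3) (Mxx_count x (huv _ erefl)).
Qed.

Lemma Cross_Mxx : Cross (variety_generated isMxx).
Proof.
split.
- exact: is_variety_generated.
- exists [set comm_identity; cube_identity]%classic; split; first exact: finite_set2.
  by rewrite variety_generatedE models_theory_Mxx.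
- by exists Mxx; split=> //; exact: (@finite_finset Mxx).
(* In commutative monoids with [x^3 = x^4], an identity amounts to equalities of powers with
   exponents at most 3. *)
apply: (@small_of_seq _ (power_identities 4)) => W M [u v] WU UM huv WM.
have cc N : variety_generated isMxx N -> satisfies N comm_identity /\ satisfies N cube_identity.
  by rewrite variety_generatedE models_theory_Mxx => h; split; apply: h; [left | right].
have [Mc M3] := cc M UM; apply: commutative_satisfies => // a x.
rewrite (cubeP M3) [RHS](cubeP M3); apply: (satisfies_powers _ _ _).1 a.
apply: WM; first by apply: mem_power_identities; rewrite ltnS geq_minl.
move=> N WN; apply/satisfies_powers => b; have [_ N3] := cc N (WU N WN).
by rewrite -!(cubeP N3); apply: satisfies_pow (huv N WN) _.
Qed.

(** M(x^2) detects letter counts truncated at 3, so counts of at most 2 are determined exactly. *)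
Lemma limited_Mxx_perm u v : limited u -> satisfies Mxx (u, v) ->
  perm_eq u v /\ limited v.
Proof.
move=> lu h; have uv : perm_eq u v.
  apply/allP => z _ /=; have := Mxx_count z h; have := lu z.
  by case: (count_mem z u) => [|[|[|k]]]; case: (count_mem z v) => [|[|[|l]]] //= _;
    rewrite !minnSS min0n.
by split=> //; apply: perm_limited uv lu.
Qed.

Lemma limited_cyc_word m : (4 <= m)%N -> limited (cyc_word m).
Proof. by move=> m4 z; rewrite cyc_count //; case: ifP. Qed.

Lemma isoterm_LAR w : limited w ->
  isoterm (variety_join (variety_generated LAR) (variety_generated isMxx)) w.
Proof.
move=> lw v /variety_join_generated [h1 h2]; apply/esym.
have [_ lv] := limited_Mxx_perm lw (h2 _ erefl).
exact: LAR_limited.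
Qed.

(** * The variety generated by the symmetric group of degree three *)

(* Coordinates (a, e) of the element r ^ a * s ^ e of S_3, where r is a 3-cycle
   and s a transposition. *)
Definition s3_mul (x y : nat * bool) : nat * bool :=
  ((x.1 + (if x.2 then 2 * y.1 else y.1)) %% 3, x.2 (+) y.2)%N.

Definition s3_ev (T : Type) (g : T -> nat * bool) (u : seq T) : nat * bool :=
  foldr (fun i z => s3_mul (g i) z) (0%N, false) u.

Definition s3_agree (u v : seq nat) : Prop :=
  forall g : nat -> nat * bool, s3_ev g u = s3_ev g v.

Definition s3_s : {perm 'I_3} := tperm ord0 (lift ord0 ord0).
Definition s3_r : {perm 'I_3} := s3_s * tperm (lift ord0 ord0) ord_max.

Definition s3_val (x : nat * bool) : {perm 'I_3} := s3_r ^+ x.1 * s3_s ^+ x.2.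

Lemma s3_relations : [/\ s3_r ^+ 3 = 1, s3_s ^+ 2 = 1, s3_s * s3_r = s3_r ^+ 2 * s3_s
  & s3_r != 1].
Proof.
have E (p q : {perm 'I_3}) : (forall i : 'I_3, val (p i) = val (q i)) -> p = q.
  by move=> h; apply/permP => i; apply: val_inj.
split; try (apply: E => -[[|[|[|//]]] ?]; rewrite ?expgS ?expg0 ?mulg1 ?permM !permE /=;
  do ?rewrite ?permM ?permE /=; by []).
by apply/eqP => /permP /(_ ord0); rewrite /s3_r /s3_s !permM !permE /= => /(congr1 val).
Qed.

Lemma s3_valM x y : s3_val (s3_mul x y) = s3_val x * s3_val y.
Proof.
have [r3 s2 sr _] := s3_relations.
have srX n : s3_s * s3_r ^+ n = s3_r ^+ (2 * n) * s3_s.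
  elim: n => [|n ih]; first by rewrite muln0 !expg0 mulg1 mul1g.
  by rewrite expgSr mulgA ih -mulgA sr mulgA -expgnDr mulnS addnC.
case: x y => [a []] [b e']; rewrite /s3_val /s3_mul /= (expg_mod _ r3) expgnDr.
  rewrite -!mulgA; congr (_ * _); rewrite expg1 mulgA [s3_s * _]srX -mulgA.
  by congr (_ * _); case: e'; rewrite ?expg0 ?expg1 ?mulg1 // -expg2 s2.
by rewrite expg0 mulg1 mulgA.
Qed.

Lemma s3_val_inj a b e e' : (a < 3)%N -> (b < 3)%N ->
  s3_val (a, e) = s3_val (b, e') -> (a, e) = (b, e').
Proof.
have [r3 s2 sr r1] := s3_relations.
have oddr : odd_perm s3_r = false by rewrite odd_permM !odd_tperm.
move=> a3 b3 E.
have ee' : e = e'.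
  have := congr1 (@odd_perm _) E; rewrite !odd_permM.
  have oX n : odd_perm (s3_r ^+ n) = false.
    by elim: n => [|n ih]; rewrite ?odd_perm1 // expgS odd_permM ih oddr.
  rewrite !oX /=; case: (e) (e') => [] []; rewrite ?expg0 ?expg1 ?odd_perm1 /s3_s ?odd_tperm //.
subst e'; congr pair; move: E => /mulIg /=.
have r2 : s3_r ^+ 2 != 1.
  by apply: contra r1 => /eqP r2; have := r3; rewrite expgS r2 mulg1 => ->.
case: a b a3 b3 => [|[|[|a]]] [|[|[|b]]] //= _ _; rewrite ?expg0 ?expg1.
- by move=> /esym/eqP; rewrite (negPf r1).
- by move=> /esym/eqP; rewrite (negPf r2).
- by move=> /eqP; rewrite (negPf r1).
- by rewrite expg2 -{1}[s3_r]mulg1 => /mulgI/esym/eqP; rewrite (negPf r1).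
- by move=> /eqP; rewrite (negPf r2).
- by rewrite expg2 -{3}[s3_r]mulg1 => /mulgI/eqP; rewrite (negPf r1).
Qed.

Lemma s3_ev_lt (T : Type) (g : T -> nat * bool) u : ((s3_ev g u).1 < 3)%N.
Proof. by case: u => //= i u; rewrite ltn_mod. Qed.

Lemma s3_val_ev (T : Type) (g : T -> nat * bool) u :
  \prod_(i <- u) s3_val (g i) = s3_val (s3_ev g u).
Proof.
elim: u => [|i u ih]; first by rewrite big_nil /s3_val !expg0 mulg1.
by rewrite big_cons ih -s3_valM.
Qed.

Lemma s3_ev_eq (T : Type) (g : T -> nat * bool) u v :
  \prod_(i <- u) s3_val (g i) = \prod_(i <- v) s3_val (g i) -> s3_ev g u = s3_ev g v.
Proof.
rewrite !s3_val_ev => E; have := s3_ev_lt g u; have := s3_ev_lt g v; move: E.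
by case: (s3_ev g u) (s3_ev g v) => [a e] [b e'] E lb la; apply: s3_val_inj.
Qed.

Definition isS3 (M : monoidType) : Prop := M = {perm 'I_3}.

Lemma s3_agree_holds u v : holds isS3 (u, v) -> s3_agree u v.
Proof. by move=> h g; apply: s3_ev_eq; exact: (h _ erefl (fun i => s3_val (g i))). Qed.

Definition exponent_identity : identity := (nseq 6 0%N, [::]).
Definition square_identity : identity := ([:: 0; 0; 1; 1], [:: 1; 1; 0; 0])%N.

(** The exponent is the group order 6. Squares are even permutations, and the alternating group has
    order 3, hence is abelian. *)
Lemma S3_identities :
  satisfies {perm 'I_3} exponent_identity /\ satisfies {perm 'I_3} square_identity.
Proof.
split=> f.
  rewrite /exponent_identity /= (ev_nseq f 6 0%N) big_nil.
  suff p6 (x : {perm 'I_3}) : x ^+ 6 = 1 by apply: p6.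
  have := @expg_cardG _ [set: {perm 'I_3}]%G x (finset.in_setT x).
  by rewrite cardsT card_Sn.
rewrite /= !big_cons big_nil !mulg1 !mulgA.
have sqA (x : {perm 'I_3}) : x * x \in 'Alt_('I_3)%g.
  by rewrite Alt_even odd_permM addbb.
have abA : abelian 'Alt_('I_3)%g.
  apply/cyclic_abelian/prime_cyclic; have := @card_Alt 'I_3; rewrite card_ord => /(_ isT).
  by case: #|_| => [|[|[|[|n]]]] // /eqP; rewrite mulnS ?mulnS.
rewrite -!mulgA [f 0%N * (f 0%N * _)]mulgA [f 1%N * (f 1%N * _)]mulgA.
exact: (centsP abA) (sqA _) _ (sqA _).
Qed.

(** * Monoids with x^6 = 1 and commuting squares *)

Section SquareMonoid.
Variable M : monoidType.
Hypothesis M6 : satisfies M exponent_identity.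
Hypothesis Msq : satisfies M square_identity.

Lemma exp6 (x : M) : x ^+ 6 = 1.
Proof. by have := M6 (fun=> x); rewrite /= big_nil (ev_nseq (fun=> x) 6 0%N). Qed.

Lemma exp7 (x : M) : x ^+ 7 = x.
Proof. by rewrite expgS exp6 mulg1. Qed.

Lemma exp_mod6 (x : M) n : x ^+ n = x ^+ (n %% 6).
Proof. by rewrite {1}(divn_eq n 6) expgnDr mulnC expgnA exp6 expg1n mul1g. Qed.

Lemma square_comm (x y : M) : commute (x ^+ 2) (y ^+ 2).
Proof.
have := Msq (fun i => if i == 0%N then x else y).
by rewrite /= !big_cons !big_nil /= !mulg1 /commute !expg2 !mulgA.
Qed.

(** Elements of exponent 3 are squares and therefore commute with one another. *)
Lemma cube1_square (x : M) : x ^+ 3 = 1 -> x = (x ^+ 2) ^+ 2.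
Proof. by move=> x3; rewrite -expgnA expgS x3 mulg1. Qed.

Lemma cube1_comm (x y : M) : x ^+ 3 = 1 -> y ^+ 3 = 1 -> commute x y.
Proof. by move=> /cube1_square -> /cube1_square ->; apply: square_comm. Qed.

Lemma cube1M (x y : M) : x ^+ 3 = 1 -> y ^+ 3 = 1 -> (x * y) ^+ 3 = 1.
Proof. by move=> x3 y3; rewrite expgMn ?x3 ?y3 ?mulg1 //; apply: cube1_comm. Qed.

Lemma square_cube1 (x : M) : (x ^+ 2) ^+ 3 = 1.
Proof. by rewrite -expgnA exp6. Qed.

Lemma exp_mod3 (x : M) n : x ^+ 3 = 1 -> x ^+ (n %% 3) = x ^+ n.
Proof. by move=> x3; rewrite {2}(divn_eq n 3) expgnDr mulnC expgnA x3 expg1n mul1g. Qed.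

Section Conj.
Variable q : M.
Hypothesis qq : q * q = 1.

Lemma mulqK (a : M) : q * (q * a) = a.
Proof. by rewrite mulgA qq mul1g. Qed.

Lemma conjq_M (a b : M) : q * (a * b) * q = (q * a * q) * (q * b * q).
Proof. by rewrite -!mulgA mulqK. Qed.

Lemma conjq_X (a : M) n : q * a ^+ n * q = (q * a * q) ^+ n.
Proof.
elim: n => [|n ih]; first by rewrite !expg0 mulg1 qq.
by rewrite !expgS conjq_M ih.
Qed.

Lemma conjq_K (a : M) : q * (q * a * q) * q = a.
Proof. by rewrite -!mulgA qq mulg1 mulqK. Qed.

Lemma conjq_cube1 (a : M) : a ^+ 3 = 1 -> (q * a * q) ^+ 3 = 1.
Proof. by move=> a3; rewrite -conjq_X a3 mulg1. Qed.

(* An involution t can be corrected by an element of exponent 3 so as to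
   commute with q. *)
Lemma correct_involution (t : M) : t * t = 1 ->
  let t' := t * (q * t) ^+ 2 in [/\ t' * t' = 1, commute q t' &
    forall p, commute p t -> commute p q -> commute p t'].
Proof.
move=> tt t'; have tK (a : M) : t * (t * a) = a by rewrite mulgA tt mul1g.
have E : t' = t * (q * (t * (q * t))) by rewrite /t' expg2 -!mulgA.
split; first by rewrite E -!mulgA !(tK, mulqK) tt.
- have inv : (t * q) ^+ 3 * (q * t) ^+ 3 = 1.
    by rewrite !expgS !expg0 !mulg1 -!mulgA !(mulqK, tK) tt.
  have : (t * q) ^+ 3 = (q * t) ^+ 3.
    rewrite -[LHS]mulg1 -(exp6 (q * t)) -[6%N]/(3 + 3)%N expgnDr mulgA inv.
    by rewrite mul1g.
  by rewrite /commute E !expgS !expg0 !mulg1 -!mulgA => ->.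
by move=> p pt pq; rewrite /t'; apply: commuteM => //; apply: commuteX; apply: commuteM.
Qed.

End Conj.

(** The new element starts as [g n ^+ 3] and is corrected against each earlier [q k] in turn. A
    correction multiplies by a square, which has exponent 3, so [g n * t] keeps exponent 3. *)
Lemma commuting_involutions (g : nat -> M) n :
  exists q : nat -> M, [/\ forall i, q i * q i = 1, forall i j, commute (q i) (q j),
    forall i, (n <= i)%N -> q i = 1 & forall i, (i < n)%N -> (g i * q i) ^+ 3 = 1].
Proof.
elim: n => [|n [q [qq qC q1 gq]]].
  by exists (fun=> 1); split=> // *; rewrite mulg1.
have [t [tt tq gt]] : exists t, [/\ t * t = 1, forall i, (i < n)%N -> commute (q i) t &
    (g n * t) ^+ 3 = 1].
  have: forall k, exists t, [/\ t * t = 1, forall i, (i < k)%N -> commute (q i) t &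
    (g n * t) ^+ 3 = 1]; last by apply.
  elim=> [|k [t [tt tq gt]]].
    exists (g n ^+ 3); split=> //; first by rewrite -expgnDr exp6.
    by rewrite -expgS -expgnA exp_mod6.
  have [t1 t2 t3] := correct_involution (qq k) tt.
  exists (t * (q k * t) ^+ 2); split=> //.
    by move=> i; rewrite ltnS leq_eqVlt => /orP[/eqP -> // | ik]; apply: t3; auto.
  by rewrite mulgA; apply: cube1M => //; apply: square_cube1.
have tqa i : commute (q i) t.
  by have [/tq //|/q1 ->] := ltnP i n; apply/commute_sym/commute1.
exists (fun i => if i == n then t else q i); split=> [i|i j|i ni|i].
- by case: ifP.
- by case: ifP => _; case: ifP => _ //; apply: commute_sym.
- by rewrite ifN ?q1 //; lia.
- by rewrite ltnS leq_eqVlt; case: eqP => [->|_] //= /gq.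
Qed.

Section Twisted.
Variable q : nat -> M.
Hypothesis qq : forall i, q i * q i = 1.
Hypothesis qC : forall i j, commute (q i) (q j).

(** The product of conjugates of the [c i] that remains when all [q i] in a product of factors
    [c i * q i] are collected on the right. *)
Definition twisted (c : nat -> M) (u : seq nat) : M :=
  foldr (fun i z => c i * (q i * z * q i)) 1 u.

Lemma ev_twisted c u : ev (fun i => c i * q i) u = twisted c u * ev q u.
Proof.
elim: u => [|i u ih]; first by rewrite !big_nil mulg1.
by rewrite !big_cons ih /= -!mulgA (mulqK (qq i)).
Qed.

Lemma twisted_cube1 c u : (forall i, c i ^+ 3 = 1) -> twisted c u ^+ 3 = 1.
Proof.
move=> c3; elim: u => [|i u ih] /=; first by rewrite expg1n.
by apply: cube1M => //; apply: conjq_cube1.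
Qed.

Lemma twistedM c d e u : (forall i, c i ^+ 3 = 1) -> (forall i, d i ^+ 3 = 1) ->
  (forall i, e i = c i * d i) -> twisted e u = twisted c u * twisted d u.
Proof.
move=> c3 d3 cde; elim: u => [|i u ih] /=; first by rewrite mulg1.
rewrite ih conjq_M // cde.
have : (q i * twisted c u * q i) ^+ 3 = 1 by apply: conjq_cube1 => //; apply: twisted_cube1.
move: (q i * twisted c u * q i) (q i * twisted d u * q i) => a b a3.
by rewrite -!mulgA; congr (_ * _); rewrite !mulgA; congr (_ * _); apply: cube1_comm.
Qed.

Lemma eq_twisted c d u : {in u, c =1 d} -> twisted c u = twisted d u.
Proof.
elim: u => //= i u ih cd; rewrite cd ?mem_head // ih // => j ju.
by apply: cd; rewrite inE ju orbT.
Qed.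

Definition single (x : nat) (c : M) (i : nat) : M := if i == x then c else 1.

(** When every [q i] fixes or inverts [c], the computation is the one in S_3 with [c] as
    rotation. *)
Lemma twisted_eigen x (c : M) (e : nat -> bool) u : c ^+ 3 = 1 ->
  (forall i, q i * c * q i = c ^+ (if e i then 2 else 1)%N) ->
  twisted (single x c) u = c ^+ (s3_ev (fun i => (nat_of_bool (i == x), e i)) u).1.
Proof.
move=> c3 ce; elim: u => //= i u ih; rewrite ih conjq_X // ce exp_mod3 // expgnDr -expgnA.
congr (_ * _); first by rewrite /single; case: eqP; rewrite ?expg1 ?expg0.
by case: (e i); rewrite ?mul1n.
Qed.

Section Agree.
Variables u v : seq nat.
Hypothesis uv : s3_agree u v.

(* Conjugation by the involutions q i is diagonalised one index at a time. *)
Lemma twisted_single k c x : c ^+ 3 = 1 ->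
  (forall i, (k <= i)%N -> q i * c * q i = c \/ q i * c * q i = c ^+ 2) ->
  twisted (single x c) u = twisted (single x c) v.
Proof.
elim: k c => [|k ih] c c3 ceig.
  have ce i : q i * c * q i = c ^+ (if (q i * c * q i)%g != c then 2 else 1)%N.
    by case: eqP => [->|] //= ne; case: (ceig i).
  by rewrite !(twisted_eigen _ _ c3 ce) uv.
have [d dE] : exists d, q k * c * q k = d by exists (q k * c * q k).
have d3 : d ^+ 3 = 1 by rewrite -dE; apply: conjq_cube1.
have cd : commute c d by apply: cube1_comm.
have cX n : (c ^+ n) ^+ 3 = 1 by rewrite expgnAC c3 expg1n.
have dX n : (d ^+ n) ^+ 3 = 1 by rewrite expgnAC d3 expg1n.
have cdX m n : commute (c ^+ m) (d ^+ n) by apply: commuteX2.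
(* Written additively over the field of three elements, where [1/2 = 2], these are [(c+d)/2] and
   [(c-d)/2]: the components of [c] that conjugation by [q k] fixes and inverts. *)
pose cp := c ^+ 2 * d ^+ 2; pose cm := c ^+ 2 * d.
have cp3 : cp ^+ 3 = 1 by apply: cube1M.
have cm3 : cm ^+ 3 = 1 by apply: cube1M.
have cpm : c = cp * cm.
  rewrite /cp /cm mulgA -(mulgA (c ^+ 2)) -cdX mulgA -mulgA -expgSr d3 mulg1.
  by rewrite -expgnDr expgS c3 mulg1.
have kc n : q k * c ^+ n * q k = d ^+ n by rewrite conjq_X // dE.
have kd n : q k * d ^+ n * q k = c ^+ n by rewrite conjq_X // -dE conjq_K.
have qkcp : q k * cp * q k = cp by rewrite conjq_M // kc kd -cdX.
have qkcm : q k * cm * q k = cm ^+ 2.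
  rewrite conjq_M // kc -[d]expg1 kd expg1 expgMn; last exact: commuteX2 1%N _.
  by rewrite -expgnA -cdX expg1 [c ^+ (2 * 2)]expgS c3 mulg1.
have qC' i a : q i * (q k * a * q k) * q i = q k * (q i * a * q i) * q k.
  by rewrite -!mulgA (qC k i) !mulgA (qC i k).
have eig a b : (forall i, (k < i)%N -> q i * a * q i = a /\ q i * b * q i = b \/
      q i * a * q i = a ^+ 2 /\ q i * b * q i = b ^+ 2) -> commute a b ->
    forall i, (k < i)%N -> q i * (a * b) * q i = a * b \/ q i * (a * b) * q i = (a * b) ^+ 2.
  move=> h ab i ki; rewrite conjq_M // expgMn //.
  by case: (h i ki) => -[-> ->]; [left | right].
have cdeig i : (k < i)%N -> q i * c * q i = c /\ q i * d * q i = d \/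
      q i * c * q i = c ^+ 2 /\ q i * d * q i = d ^+ 2.
  by move=> ki; case: (ceig i ki) => E; [left | right]; rewrite -dE E qC' E ?kc ?dE.
have Xeig a b m n : (q a * b * q a = b -> q a * b ^+ n * q a = b ^+ n) /\
    (q a * b * q a = b ^+ m -> q a * b ^+ n * q a = (b ^+ n) ^+ m).
  by rewrite conjq_X //; split=> ->; rewrite // expgnAC.
have Pp : twisted (single x cp) u = twisted (single x cp) v.
  apply: ih => // i; rewrite leq_eqVlt => /orP[/eqP <-|ki]; first by left.
  apply: eig ki; last exact: cdX.
  by move=> j /cdeig [[h1 h2]|[h1 h2]]; [left | right]; split; apply Xeig.
have Pm : twisted (single x cm) u = twisted (single x cm) v.
  apply: ih => // i; rewrite leq_eqVlt => /orP[/eqP <-|ki]; first by right.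
  apply: eig ki; last by apply: (cdX 2 1)%N.
  by move=> j /cdeig [[h1 h2]|[h1 h2]]; [left | right]; split=> //; apply Xeig.
have s3 y a : a ^+ 3 = 1 -> forall i, single y a i ^+ 3 = 1.
  by move=> a3 i; rewrite /single; case: ifP; rewrite ?expg1n.
have sM i : single x c i = single x cp i * single x cm i.
  by rewrite /single; case: ifP; rewrite ?mulg1.
by rewrite !(twistedM _ (s3 x _ cp3) (s3 x _ cm3) sM) Pp Pm.
Qed.

(** By [twistedM], [c] splits into factors supported on one letter; the diagonalisation starts at
    [n], beyond which conjugation is trivial. *)
Lemma twisted_agree n c : (forall i, (n <= i)%N -> q i = 1) -> (forall i, c i ^+ 3 = 1) ->
  twisted c u = twisted c v.
Proof.
move=> q1 c3; have [m [um vm]] := word_bound u v.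
have E w : all (fun i => i < m)%N w ->
    twisted c w = twisted (fun i => if (i < m)%N then c i else 1) w.
  by move=> /allP wm; apply: eq_twisted => i /wm ->.
rewrite (E u um) (E v vm) {E um vm}; elim: m => [|m ih].
  by rewrite -!(@eq_twisted (single 0 1)) ?(@twisted_single n) // ?expg1n // => i *;
    rewrite /single ?q1 ?mulg1; auto; case: ifP.
have tr3 k i : (if (i < k)%N then c i else 1) ^+ 3 = 1 by case: ifP; rewrite ?expg1n.
have s3 i : single m (c m) i ^+ 3 = 1 by rewrite /single; case: ifP; rewrite ?expg1n.
have sM i : (if (i < m.+1)%N then c i else 1) =
    (if (i < m)%N then c i else 1) * single m (c m) i.
  rewrite /single ltnS leq_eqVlt; case: eqP => [->|_]; rewrite ?ltnn ?mul1g //=.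
  by rewrite mulg1.
rewrite !(twistedM _ (tr3 m) s3 sM) ih (@twisted_single n) // => i /q1 ->.
by left; rewrite mulg1 mul1g.
Qed.

End Agree.
End Twisted.

Lemma s3_agree_count u v x : s3_agree u v -> odd (count_mem x u) = odd (count_mem x v).
Proof.
have E w : (s3_ev (fun i => (0%N, i == x)) w).2 = odd (count_mem x w).
  by elim: w => //= i w ->; rewrite oddD; case: (i == x).
by move=> uv; rewrite -!E uv.
Qed.

(** Each value [f i] is an element of exponent 3 times [q i]. The twisted parts agree by
    [twisted_agree], and the commuting [q i] only see parities of letter counts. *)
Lemma s3_agree_satisfies u v : s3_agree u v -> satisfies M (u, v).
Proof.
move=> uv f /=; have [n [un vn]] := word_bound u v.
have [q [qq qC q1 fq]] := commuting_involutions f n.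
pose c i := if (i < n)%N then f i * q i else 1.
have c3 i : c i ^+ 3 = 1 by rewrite /c; case: ifP => [/fq //|_]; rewrite expg1n.
have E w : all (fun i => i < n)%N w -> ev f w = twisted q c w * ev q w.
  move=> /allP wn; rewrite -ev_twisted //; apply: ev_eq_in => i /wn /= iw.
  by rewrite /c iw -mulgA qq mulg1.
have qX i k : q i ^+ k = q i ^+ (odd k).
  by rewrite -{1}(odd_double_half k) expgnDr -mul2n expgnA expg2 qq expg1n mulg1.
rewrite (E u un) (E v vn) (twisted_agree qq qC uv q1 c3); congr (_ * _).
rewrite (ev_commute qC un) (ev_commute qC vn); apply: eq_bigr => i _.
by rewrite qX (s3_agree_count i uv) -qX.
Qed.

(* The exponents (x, y, N) such that u takes the value c^x (t c t^-1)^y t^N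
   when the letter i takes the value c^a t^e, where g i = (a, e). *)
Fixpoint square_exponents (g : nat -> nat * bool) (u : seq nat) : nat * nat * nat :=
  if u is i :: u' then
    let: (x, y, N) := square_exponents g u' in
    if (g i).2 then ((g i).1 + y, x, N.+1)%N else ((g i).1 + x, y, N)%N
  else (0, 0, 0)%N.

Lemma s3_ev_exponents g u : s3_ev g u =
  let: (x, y, N) := square_exponents g u in ((x + 2 * y) %% 3, odd N)%N.
Proof.
elim: u => //= i u ->; case: (square_exponents g u) => [[x y] N].
by rewrite /s3_mul /=; case: (g i) => [a []] /=; congr pair; lia.
Qed.

Lemma conj_cube1 (c t : M) : c ^+ 3 = 1 -> (t * c * t ^+ 5) ^+ 3 = 1.
Proof.
move=> c3; set c' := t * c * t ^+ 5.
have tc : t * c = c' * t by rewrite /c' -mulgA -expgSr exp6 mulg1.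
have X n : c' ^+ n * t = t * c ^+ n.
  elim: n => [|n ih]; first by rewrite !expg0 mulg1 mul1g.
  by rewrite expgSr -mulgA -tc mulgA ih -mulgA -expgSr.
have := congr1 (fun z => z * t ^+ 5) (X 3); rewrite /= c3 mulg1 -mulgA -expgS exp6.
by rewrite mulg1.
Qed.

(** Moving [t] to the right swaps [c] with its conjugate: [t^5] is the inverse of [t], and [t^2]
    commutes with [c] since both have exponent 3. *)
Lemma ev_square_exponents (c t : M) (g : nat -> nat * bool) u : c ^+ 3 = 1 ->
  ev (fun i => c ^+ (g i).1 * t ^+ (g i).2) u =
  let: (x, y, N) := square_exponents g u in c ^+ x * (t * c * t ^+ 5) ^+ y * t ^+ N.
Proof.
move=> c3; set c' := t * c * t ^+ 5.
have tc : t * c = c' * t by rewrite /c' -mulgA -expgSr exp6 mulg1.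
have c'3 : c' ^+ 3 = 1 by apply: conj_cube1.
have tc' : t * c' = c * t.
  rewrite /c' (mulgA t (t * c)) (mulgA t t c) -expg2 (cube1_comm (square_cube1 t) c3).
  by rewrite -mulgA -expgnDr exp7.
have tcX n : t * c ^+ n = c' ^+ n * t.
  elim: n => [|n ih]; first by rewrite !expg0 mulg1 mul1g.
  by rewrite expgSr mulgA ih -mulgA tc mulgA -expgSr.
have tc'X n : t * c' ^+ n = c ^+ n * t.
  elim: n => [|n ih]; first by rewrite !expg0 mulg1 mul1g.
  by rewrite expgSr mulgA ih -mulgA tc' mulgA -expgSr.
elim: u => [|i u ih]; first by rewrite big_nil /= !expg0 !mulg1.
rewrite big_cons ih /= expgb; case: (square_exponents g u) => [[x y] N].
have CC m n : commute (c ^+ m) (c' ^+ n) by apply: commuteX2; apply: cube1_comm.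
case: (g i) => [a []] /=; last by rewrite mulg1 expgnDr -!mulgA.
rewrite expgnDr expgS -!mulgA; congr (_ * _).
by rewrite mulgA tcX -mulgA (mulgA t) tc'X !mulgA CC.
Qed.

(** Since [x = x^4 x^3] with [x^4] central, it suffices that the involutions [t = a^3] and [u = b^3]
    commute. Centrality gives [(tu)^2 = (ut)^2], its own inverse; with [(tu)^6 = 1] this yields
    [(tu)^2 = 1]. *)
Lemma squares_central_commutative :
  (forall s t : M, commute (s ^+ 2) t) -> forall a b : M, commute a b.
Proof.
move=> sqC a b.
have inv (x : M) : x ^+ 3 * x ^+ 3 = 1 by rewrite -expgnDr exp6.
have dec (x : M) : x = (x ^+ 2) ^+ 2 * x ^+ 3 by rewrite -expgnA -expgnDr exp7.
have tu : commute (a ^+ 3) (b ^+ 3).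
  move: (a ^+ 3) (b ^+ 3) (inv a) (inv b) => t u tt uu.
  have tK (z : M) : t * (t * z) = z by rewrite mulgA tt mul1g.
  have uK (z : M) : u * (u * z) = z by rewrite mulgA uu mul1g.
  have d1 : (t * u) ^+ 2 = 1.
    have E : (t * u) ^+ 2 = (u * t) ^+ 2.
      have := sqC (t * u) t; rewrite /commute !expg2 -!mulgA tK => E.
      have := congr1 (fun z => t * z) E; rewrite /= !tK.
      by move=> E2; rewrite E2 -E.
    have d2 : (t * u) ^+ 2 * (t * u) ^+ 2 = 1.
      by rewrite {2}E !expg2 -!mulgA !(uK, tK) tt.
    move: ((t * u) ^+ 2) (square_cube1 (t * u)) d2 => z z3 zz.
    by move: z3; rewrite expgS expg2 zz mulg1.
  have := congr1 (fun z => z * (u * t)) d1; rewrite /= expg2 mul1g -!mulgA uK tt mulg1.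
  by [].
rewrite (dec a) (dec b); apply: commuteM; apply/commute_sym.
  by apply: commuteM; apply: sqC.
apply: commuteM; first exact/commute_sym/sqC.
exact: commute_sym.
Qed.

Lemma disagree_commutative u v : satisfies M (u, v) -> ~ s3_agree u v ->
  forall a b : M, commute a b.
Proof.
move=> Muv /existsNP [g]; rewrite !s3_ev_exponents.
have := fun c t => @ev_square_exponents c t g v; have := fun c t => @ev_square_exponents c t g u.
case: (square_exponents g u) => [[x y] N]; case: (square_exponents g v) => [[x' y'] N'].
move=> evu evv ne.
have E (s t : M) : let c := s ^+ 2 in let c' := t * c * t ^+ 5 in
    c ^+ x * c' ^+ y * t ^+ N = c ^+ x' * c' ^+ y' * t ^+ N'.
  move=> c c'; rewrite -evu -?evv ?square_cube1 //; exact: Muv.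
have EN (t : M) : t ^+ N = t ^+ N'.
  have := E 1 t; rewrite /= expg1n mulg1 -expgS exp6 !expg1n !mul1g.
  by [].
(* If the parities differ, [N + 5N'] is odd and [t^(N+5N') = t^(6N') = 1]; cubing gives exponent 3,
   hence commutativity. *)
have [eN|neN] := eqVneq (odd N) (odd N'); last first.
  have t3 (t : M) : t ^+ 3 = 1.
    have E1 : t ^+ (N + 5 * N') = 1.
      by rewrite expgnDr EN -expgnDr -mulSn mulnC exp_mod6 modnMl.
    have := congr1 (fun z => z ^+ 3) E1; rewrite /= expg1n -expgnA exp_mod6.
    suff -> : ((N + 5 * N') * 3 %% 6 = 3)%N by [].
    by move: neN; lia.
  by move=> a b; apply: cube1_comm.
have {}ne : ((x + 2 * x') %% 3 <> (y + 2 * y') %% 3)%N.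
  by move=> e; apply: ne; congr pair => //; lia.
(* The powers of [t] cancel and the right side is moved over, with [2] acting as [-1] modulo 3. *)
have E3 (s t : M) : let c := s ^+ 2 in let c' := t * c * t ^+ 5 in
    c ^+ ((x + 2 * x') %% 3) * c' ^+ ((y + 2 * y') %% 3) = 1.
  move=> c c'; have c3 : c ^+ 3 = 1 by apply: square_cube1.
  have c'3 : c' ^+ 3 = 1 by apply: conj_cube1.
  have EE : c ^+ x * c' ^+ y = c ^+ x' * c' ^+ y'.
    have E0 : c ^+ x * c' ^+ y * t ^+ N = c ^+ x' * c' ^+ y' * t ^+ N' := E s t.
    have := congr1 (fun z => z * t ^+ (5 * N)) E0; move: (c ^+ x * c' ^+ y) (c ^+ x' * c' ^+ y').
    move=> a b.
    rewrite /= -EN -!mulgA -expgnDr -mulSn (expgnA t 6) exp6 expg1n !mulg1; exact.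
  have A1 : c ^+ (2 * x') * c ^+ x' = 1 by rewrite -expgnDr -mulSnr expgnA c3 expg1n.
  have A2 : c' ^+ y' * c' ^+ (2 * y') = 1 by rewrite -expgnDr -mulSn expgnA c'3 expg1n.
  rewrite !exp_mod3 // (addnC x) (expgnDr c _ x) (expgnDr c' y) -mulgA (mulgA (c ^+ x)) EE.
  by rewrite -(mulgA (c ^+ x')) A2 mulg1.
apply: squares_central_commutative => s t.
(* At [t = 1] this reads [c^(X+Y) = 1], so [c = 1] unless [X], [Y] are 1 and 2 in some order; then
   the instance at [t] gives [c' = c]. *)
have := E3 s t; have := E3 s 1; rewrite /= mul1g expg1n mulg1.
set c := s ^+ 2; set c' := t * c * t ^+ 5.
have c3 : c ^+ 3 = 1 by apply: square_cube1.
have c'3 : c' ^+ 3 = 1 by apply: conj_cube1.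
have tc : t * c = c' * t by rewrite /c' -mulgA -expgSr exp6 mulg1.
have trivial_c : c = 1 -> commute c t by move=> ->; apply/commute_sym/commute1.
have same_c : c' = c -> commute c t by move=> e; rewrite /commute tc e.
have sq1 (z : M) : z ^+ 3 = 1 -> z ^+ 2 = 1 -> z = 1.
  by move=> z3 z2; rewrite -z3 expgS z2 mulg1.
have := ltn_pmod (x + 2 * x') (isT : 0 < 3)%N; have := ltn_pmod (y + 2 * y') (isT : 0 < 3)%N.
move: ((x + 2 * x') %% 3)%N ((y + 2 * y') %% 3)%N ne => X Y.
case: X => [|[|[|X]]]; case: Y => [|[|[|Y]]] //= _ _ _.
- by rewrite !expg1 expg0 mul1g => /trivial_c.
- by rewrite expg0 !mul1g => /(sq1 _ c3) /trivial_c.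
- by rewrite !expg1 expg0 mulg1 => /trivial_c.
- rewrite expg1 => _ cc'; apply: same_c.
  by rewrite -[c']mul1g -cc' -mulgA -expgSr c'3 mulg1.
- by rewrite expg0 mulg1 => /(sq1 _ c3) /trivial_c.
- rewrite expg1 => _ cc'; apply: same_c.
  by rewrite -[RHS]mulg1 -cc' mulgA -expgS c3 mul1g.
Qed.
End SquareMonoid.

Lemma models_theory_S3 :
  models (theory isS3) = models [set exponent_identity; square_identity]%classic.
Proof.
have [h1 h2] := S3_identities.
apply/funext => M; apply/propext; split=> [h e [->|->]|h [u v] huv].
- by apply: h => N ->.
- by apply: h => N ->.
apply: s3_agree_satisfies; last exact: s3_agree_holds.
  by apply: h; left.
by apply: h; right.
Qed.

Lemma Cross_S3 : Cross (variety_generated isS3).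
Proof.
split.
- exact: is_variety_generated.
- exists [set exponent_identity; square_identity]%classic; split; first exact: finite_set2.
  by rewrite variety_generatedE models_theory_S3.
- by exists {perm 'I_3}; split=> //; exact: (@finite_finset {perm 'I_3}).
(* An identity of S_3 holds throughout; any other makes the subvariety commutative, where only
   powers with exponents modulo 6 matter. *)
apply: (@small_of_seq _ (comm_identity :: power_identities 6)) => W M [u v] WU UM huv WM.
have ES N : variety_generated isS3 N ->
    satisfies N exponent_identity /\ satisfies N square_identity.
  by rewrite variety_generatedE models_theory_S3 => h; split; apply: h; [left | right].
have [M6 Msq] := ES M UM.
have [uv|nuv] := pselect (s3_agree u v); first exact: s3_agree_satisfies.
apply: commutative_satisfies => [|a x].
  apply: WM => [|N WN]; first by rewrite mem_head.
  have [N6 Nsq] := ES N (WU N WN).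
  by apply/commP; apply: (disagree_commutative N6 Nsq (huv N WN)).
rewrite (exp_mod6 M6) [RHS](exp_mod6 M6); apply: (satisfies_powers _ _ _).1 a.
apply: WM; first by rewrite inE mem_power_identities ?orbT ?ltn_mod.
move=> N WN; apply/satisfies_powers => b; have [N6 _] := ES N (WU N WN).
by rewrite -!(exp_mod6 N6); apply: satisfies_pow (huv N WN) _.
Qed.

(** * Cyclic words as isoterms for the join with the variety of S_3 *)

Definition s3_test : seq (bool -> nat * bool) :=
  [seq (fun b => if b then x else y) | x <- [:: (0, false); (0, true)]%N,
                                       y <- [:: (1, false); (1, true)]%N].

(** [A] restricts the common prefix of two words, the marked [false] is the next letter of the
    second word, and [B] restricts what the first word has before that letter. *)
Definition parity_checkb (A B C D : seq bool) : bool :=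
  let U := A ++ B ++ false :: C in let V := A ++ false :: D in
  [&& false \notin B, count_mem true U == 2, count_mem false U == 2,
      count_mem true V == 2, count_mem false V == 2 &
      all (fun g => s3_ev g U == s3_ev g V) s3_test]%N ==>
  ~~ odd (count_mem true B).

Lemma parity_check : all (fun A => all (fun B => all (fun C => all
    (parity_checkb A B C) (bool_words 3)) (bool_words 3)) (bool_words 2)) (bool_words 3).
Proof. by vm_compute. Qed.

Lemma s3_agree_bool_word u v x y (g : bool -> nat * bool) : x != y ->
  satisfies {perm 'I_3} (u, v) ->
  s3_ev g (bool_word x y u) = s3_ev g (bool_word x y v).
Proof. by move=> xy h; apply: s3_ev_eq; apply: satisfies_bool_word xy h. Qed.

(** At the first difference [v] continues with [y], while the cyclic word has a block [t] before its
    next [y]. By [parity_check] every letter occurs in [t] an even number of times, so [t] is empty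
    by [cyc_word_even_factor]. *)
Lemma isoterm_S3_cyc_word m : (4 <= m)%N ->
  isoterm (variety_join (variety_generated isS3) (variety_generated isMxx)) (cyc_word m).
Proof.
move=> m4 v /variety_join_generated [h1 h2]; apply/esym.
have {}h1 := h1 _ erefl.
have [pv lv] := limited_Mxx_perm (limited_cyc_word m4) (h2 _ erefl).
suff H w u v' : cyc_word m = w ++ u -> v = w ++ v' -> u = v' by apply: (H [::]).
elim: u v' w => [|x u ih] v' w Eu Ev.
  by move: pv; rewrite Eu Ev perm_cat2l perm_sym => /perm_nilP ->.
have : perm_eq (x :: u) v' by move: pv; rewrite Eu Ev perm_cat2l.
case: v' Ev => [|y v'] Ev puv; first by have := perm_size puv.
have [exy|xy] := eqVneq x y.
  subst y; congr (_ :: _); apply: (ih _ (rcons w x)); rewrite cat_rcons //.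
have yu : y \in x :: u by rewrite (perm_mem puv) mem_head.
have iu : (index y (x :: u) < size (x :: u))%N by rewrite index_mem.
have := drop_cons2 iu; rewrite nth_index //.
set t := take _ _; set r := drop _ _ => Et.
have yt : y \notin t by rewrite in_take ?ltnn.
suff t0 : t = [::] by move: Et; rewrite t0 => -[] /eqP; rewrite (negPf xy).
apply: (cyc_word_even_factor m4) => [|z]; first by rewrite Eu Et.
have [->|zy] := eqVneq z y; first by rewrite (count_memPn yt).
have cp z' : z' \in cyc_word m -> count_mem z' (cyc_word m) = 2%N.
  by move=> /mem_cyc_word; rewrite cyc_count // => -> //; lia.
have [zp|] := boolP (z \in cyc_word m); last first.
  rewrite Eu Et !mem_cat => /norP [_ /norP [zt _]]; by rewrite (count_memPn zt).
have yp : y \in cyc_word m by rewrite Eu mem_cat yu orbT.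
pose B := bool_word z y.
have BU : B (cyc_word m) = B w ++ B t ++ false :: B r.
  by rewrite /B Eu Et !bool_word_cat bool_word_y.
have BV : B v = B w ++ false :: B v' by rewrite /B Ev bool_word_cat bool_word_y.
have ct1 : count_mem true (B (cyc_word m)) = 2%N by rewrite /B count_bool_word_true // cp.
have cf1 : count_mem false (B (cyc_word m)) = 2%N by rewrite /B count_bool_word_false // cp.
have ct2 : count_mem true (B v) = 2%N.
  by rewrite /B count_bool_word_true // -(seq.permP pv) cp.
have cf2 : count_mem false (B v) = 2%N.
  by rewrite /B count_bool_word_false // -(seq.permP pv) cp.
have sU := size_bool_word (B (cyc_word m)); have sV := size_bool_word (B v).
move: sU sV; rewrite ct1 cf1 ct2 cf2 {1}BU {1}BV !size_cat /= => sU sV.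
have fB : false \notin B t.
  by rewrite -has_pred1 has_count /B count_bool_word_false // -has_count has_pred1.
have sBt : (size (B t) <= 2)%N.
  rewrite size_bool_word (count_memPn fB) addn0 -[X in (_ <= X)%N]ct1 BU !count_cat.
  exact: leq_trans (leq_addr _ _) (leq_addl _ _).
have H := parity_check.
have {}H := allP H _ (mem_bool_words (ltac:(lia) : (size (B w) <= 3)%N)).
have {}H := allP H _ (mem_bool_words sBt).
have {}H := allP H _ (mem_bool_words (ltac:(lia) : (size (B r) <= 3)%N)).
have {H} := allP H _ (mem_bool_words (ltac:(lia) : (size (B v') <= 3)%N)).
have ag : all (fun g => s3_ev g (B (cyc_word m)) == s3_ev g (B v)) s3_test.
  by apply/allP => g _; rewrite /B (s3_agree_bool_word g zy h1).
rewrite /parity_checkb -BU -BV fB ct1 cf1 ct2 cf2 ag !eqxx => /implyP /(_ isT).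
by rewrite count_bool_word_true.
Qed.

Theorem mainTheorem3 (U V : monoidClass)
  (hU : U = variety_generated (fun M : monoidType =>
              M = adjoin1 L2 \/ M = adjoin1 A0 \/ M = adjoin1 R2) \/
        U = variety_generated (fun M : monoidType => M = {perm 'I_3}))
  (hV : V = variety_generated (fun M : monoidType => M = Mxx)) :
  [/\ Cross U, Cross V,
      equipotent (set nat) (subvariety (variety_join U V))
    & ~ ascending_chain_condition (@subvariety_le (variety_join U V))].
Proof.
(* Indices are shifted by 4 to meet the bound [4 <= m] of the lemmas on cyclic words. *)
have iso n : isoterm (variety_join U V) (cyc_word n.+4).
  rewrite hV; case: hU => ->; first by apply/isoterm_LAR/limited_cyc_word.
  exact: isoterm_S3_cyc_word.
have var : is_variety (variety_join U V) by apply: is_variety_generated.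
have nonempty n : cyc_word n.+4 <> [::] by [].
have avoids k m s : k <> m -> infix (wsubst s (cyc_word k.+4)) (cyc_word m.+4) ->
    wsubst s (cyc_word k.+4) = [::].
  by move=> km; apply: cyc_embed => //; case.
split.
- by case: hU => ->; [exact: Cross_LAR | exact: Cross_S3].
- by rewrite hV; exact: Cross_Mxx.
- exact: (subvarieties_continuum var iso nonempty avoids).
- exact: (subvarieties_not_acc var iso nonempty avoids).
Qed.
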